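(* Let $V$ be a finite set of sites, and let $\mathcal{A}_1$ and $\mathcal{A}_0$ be finite collections of nonempty subsets of $V$. For $S\in\{-1,1\}^V$ and $A\subset V$ put $S_A=\prod_{i\in A}S_i$. Let $(x_A)_{A\in\mathcal{A}_1}$ and $(x_B)_{B\in\mathcal{A}_0}$ be nonnegative reals, and let $(J_A)_{A\in\mathcal{A}_1}$, $(J_B)_{B\in\mathcal{A}_0}$ be independent standard Gaussian random variables. Define $$Z_1=\sum_{S\in\{-1,1\}^V}\exp\Big(\sum_{A\in\mathcal{A}_1}(\sqrt{x_A}J_A+x_A)S_A\Big),\qquad Z_0=\sum_{S\in\{-1,1\}^V}\exp\Big(\sum_{B\in\mathcal{A}_0}(\sqrt{x_B}J_B+x_B)S_B\Big),$$ and for any function $f$ of $S$ let $\langle f\rangle_0=Z_0^{-1}\sum_{S}f(S)\exp\big(\sum_{B\in\mathcal{A}_0}(\sqrt{x_B}J_B+x_B)S_B\big)$ be the Gibbs average with respect to $Z_0$. Then $$\mathbb{E}[\log Z_1]\ \ge\ \mathbb{E}[\log Z_0]+\mathbb{E}\left[\frac12\sum_{A\in\mathcal{A}_1}x_A\big(1+\langle S_A\rangle_0\big)-\frac12\sum_{B\in\mathcal{A}_0}x_B\big(1+\langle S_B\rangle_0\big)\right],$$ where $\mathbb{E}$ denotes expectation over all the Gaussian variables.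
   Context: Each of $Z_1,Z_0$ is the partition function of an Ising spin-glass model on the Nishimori line written in the parametrization $\beta_A=\sqrt{x_A}/\sigma_A$, $J_{A0}=\sigma_A\sqrt{x_A}$: i.e. $Z=\sum_S\exp(\sum_A\beta_A J'_A S_A)$ with $J'_A$ independent Gaussian of mean $J_{A0}$ and variance $\sigma_A^2>0$, satisfying $\beta_A=J_{A0}/\sigma_A^2$; $\mathbb{E}[\log Z]$ depends only on the $x_A$. *)

(* Defs.v *)
From HB Require Import structures.
From mathcomp Require Import all_boot all_order all_algebra.
From mathcomp Require Import all_classical all_reals all_analysis.
Set Implicit Arguments.
Unset Strict Implicit.
Unset Printing Implicit Defensive.
Import Order.TTheory GRing.Theory Num.Theory.
Local Open Scope ring_scope.

Definition spin {R : ringType} (b : bool) : R := if b then 1 else -1.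

Definition spinprod {R : ringType} {V : finType} (S : {ffun V -> bool})
  (A : {set V}) : R := \prod_(i in A) spin (S i).

Definition hamil {R : realType} {V : finType} (col : {set {set V}})
  (x J : {set V} -> R) (S : {ffun V -> bool}) : R :=
  \sum_(A in col) (Num.sqrt (x A) * J A + x A) * spinprod S A.

Definition Zpart {R : realType} {V : finType} (col : {set {set V}})
  (x J : {set V} -> R) : R :=
  \sum_(S : {ffun V -> bool}) expR (hamil col x J S).

Definition gibbs {R : realType} {V : finType} (col : {set {set V}})
  (x J : {set V} -> R) (f : {ffun V -> bool} -> R) : R :=
  (\sum_(S : {ffun V -> bool}) f S * expR (hamil col x J S)) / Zpart col x J.

(* Expectation over independent standard Gaussians (J_i)_{i in T}, T finite:
   iterated integrals against the standard normal law, one coordinate at a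
   time (coordinates not yet integrated are taken from [base]). *)
Fixpoint gaussE_seq {R : realType} {T : eqType} (s : seq T)
  (F : (T -> R) -> \bar R) (base : T -> R) : \bar R :=
  match s with
  | [::] => F base
  | i :: s' => (\int[normal_prob 0 1]_t
                  gaussE_seq s' F (fun j => if j == i then t else base j))%E
  end.

Definition gaussE {R : realType} {T : finType} (F : (T -> R) -> \bar R) : \bar R :=
  gaussE_seq (enum T) F (fun _ => 0).

(* Main.v *)
Require Import Defs.
From HB Require Import structures.
From mathcomp Require Import all_boot all_order all_algebra.
From mathcomp Require Import all_classical all_reals all_analysis.
From mathcomp Require Import measurable_realfun ring lra.
Import Order.TTheory GRing.Theory Num.Theory.
Local Open Scope ring_scope.

(* Write [k A = sqrt (x A) * J A + x A] for the random couplings and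
   [f x = E log Z] for the free energy, viewed as a function of the vector [x] of
   nonnegative strengths (extended by [0] outside of the collection); for the
   strengths [x0] the right-hand side is the tangent of [f] at [x0], evaluated at
   [x1], so the inequality is the convexity of [f].
   Increasing [x A] by [d] adds to [k A] an independent Gaussian of mean and
   variance [d].  By a third order Taylor expansion in that increment, up to
   [O(d ^ (3 / 2))] uniformly in [x], [f] increases by
   [d * E (m_A + (1 - m_A ^ 2) / 2)] with [m_A = <S_A>], and [E m_B] increases by
   [d * E (c_AB * (1 - m_A))] with [c_AB = <S_A S_B> - m_A m_B].  The Nishimori
   identities turn these into [d * E (1 + m_A) / 2] and [d * E (c_AB ^ 2)], and
   the matrix [c_AB ^ 2] is positive semidefinite as a Hadamard square of a
   covariance.  The tangent inequality follows by summing the expansions along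
   [n ^ 2] equal subdivisions of the segment from [x0] to [x1]. *)

(** Strengths may vanish, for instance for a subset lying in only one of the two collections, and
    [Num.sqrt (x A)] is not differentiable there. This is why [f] is expanded along increments of
    the strengths instead of being differentiated, and why only nonnegative increments inside the
    orthant are considered. The increment has size about [sqrt d], so its first two moments, [d] and
    [d + d ^ 2], give the coefficient of [d], and the cubic remainder gives the exponent [3 / 2].
    [f] is never expanded to second order: its slopes are expanded in turn, and positive
    semidefiniteness shows that the slope along the segment decreases by no more than the
    accumulated error. The Nishimori identities are Bayes' rule. If [tau] is uniform and the
    coupling of [A] has mean [tau_A x_A] and variance [x_A], the posterior law of [tau] is the Gibbs
    measure, and a gauge transformation brings every [tau] back to the all-plus configuration. All
    functions of the couplings that get averaged are Lipschitz in each coupling, uniformly in the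
    others. This one class supports integrability, Fubini and rotation invariance. *)

(** * Reflection, translation and rotation of the standard normal law, for nonnegative integrands *)

Section Gaussian.
Set Implicit Arguments.
Unset Strict Implicit.
Import numFieldNormedType.Exports.
Local Open Scope classical_set_scope.
Context {R : realType}.
Implicit Types (F G : R -> R) (a b c t : R).

Local Notation mu := (@lebesgue_measure R).
Local Notation gam := (@normal_prob R 0 1).
Local Notation phi := (@normal_pdf R 0 1).

(** The Radon-Nikodym derivative of the normal law and [phi] have the same integral over every
    measurable set, so they agree almost everywhere. *)
Lemma ge0_integral_normal_prob (f : R -> \bar R) :
  measurable_fun [set: R] f -> (forall t, 0 <= f t)%E ->
  (\int[gam]_t f t = \int[mu]_t (f t * (phi t)%:E))%E.
Proof.
move=> mf f0.
have dom := @normal_prob_dominates R 0 1.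
rewrite -(Radon_Nikodym_SigmaFinite.change_of_variables dom f0)//.
have intg := Radon_Nikodym_SigmaFinite.f_integrable dom.
apply: ae_eq_integral => //.
- apply: emeasurable_funM => //; exact: (measurable_int _ intg).
- apply: emeasurable_funM => //; apply/measurable_EFinP.
  exact: measurable_normal_pdf.
- apply: ae_eqe_mul2l; apply: integral_ae_eq => //.
  + by apply/measurable_EFinP; exact: measurable_normal_pdf.
  + by move=> E _ mE; rewrite -Radon_Nikodym_SigmaFinite.f_integral.
Qed.

Lemma stdnormal_pdfE t : phi t = normal_peak 1 * expR (- t ^+ 2 / 2).
Proof.
by rewrite normal_pdfE ?oner_neq0// /normal_fun subr0 expr1n.
Qed.

Lemma continuous_pdf : continuous phi.
Proof. by apply: continuous_normal_pdf; exact: oner_neq0. Qed.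

Lemma ge0_integral_affine a b G : 0 < a -> continuous G ->
  (forall t, 0 <= G t) ->
  (\int[mu]_t (G t)%:E = \int[mu]_t (a * G (a * t + b))%:E)%E.
Proof.
move=> a0 cG G0.
pose F (t : R) := a * t + b.
have dF t : is_derive t 1 F a.
  by apply: is_derive_eq; rewrite addr0 /GRing.scale/= mulr1.
have F'E : F^`() = cst a.
  by apply/funext => t; rewrite derive1E; apply: derive_val.
rewrite (@increasing_ge0_integration_by_substitutionT R F G)//.
- by apply: eq_integral => t _; rewrite F'E /= mulrC.
- by move=> x y xy; rewrite /F ltrD2r ltr_pM2l.
- by rewrite F'E => ?; exact: cvg_cst.
- by rewrite F'E; exact: is_cvg_cst.
- by rewrite F'E; exact: is_cvg_cst.
- apply: (@cvg_comp _ _ _ ( *%R a) (fun x => x + b)); last exact: cvg_addrr_Ny.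
  by apply/gt0_cvgMrNy => //.
- apply: (@cvg_comp _ _ _ ( *%R a) (fun x => x + b)); last exact: cvg_addrr.
  by apply/gt0_cvgMry => //.
Qed.

Lemma ge0_integral_opp G : continuous G -> (forall t, 0 <= G t) ->
  (\int[mu]_t (G t)%:E = \int[mu]_t (G (- t))%:E)%E.
Proof.
have split_at0 (H : R -> R) : continuous H -> (forall t, 0 <= H t) ->
    (\int[mu]_t (H t)%:E =
     \int[mu]_(t in `]-oo, 0%R]) (H t)%:E + \int[mu]_(t in `[0%R, +oo[) (H t)%:E)%E.
  move=> cH H0; have mH : measurable_fun [set: R] (EFin \o H).
    by apply/measurable_EFinP; exact: continuous_measurable_fun.
  rewrite -integral_itv_obnd_cbnd; last exact: measurable_funTS.
  rewrite -ge0_integral_setU//=.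
  - by rewrite -setCitvr setvU.
  - exact: measurable_funTS.
  - by move=> x _; rewrite lee_fin.
  - rewrite disj_set2E; apply/eqP; rewrite -subset0 => x/=.
    by rewrite !in_itv/= andbT ltNge => -[? /negP].
have half (H : R -> R) : continuous H -> (forall t, 0 <= H t) ->
    (\int[mu]_(t in `]-oo, 0%R]) (H t)%:E =
     \int[mu]_(t in `[0%R, +oo[) (H (- t))%:E)%E.
  move=> cH H0; have := @ge0_integration_by_substitutionNy R H 0.
  rewrite oppr0; apply; last by [].
  exact: continuous_subspaceT.
move=> cG G0.
have cGN : continuous (fun t => G (- t)).
  by move=> t; apply: (@continuous_comp _ _ _ -%R G); [exact: opp_continuous|exact: cG].
rewrite (split_at0 G)// (split_at0 (fun t => G (- t)))// half// addeC.
rewrite (half (fun t => G (- t)))//; congr (_ + _)%E.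
by under [RHS]eq_integral do rewrite opprK.
Qed.

Lemma ge0_gauss_continuous F : continuous F -> (forall t, 0 <= F t) ->
  (\int[gam]_t (F t)%:E = \int[mu]_t (F t * phi t)%:E)%E.
Proof.
move=> cF F0; rewrite ge0_integral_normal_prob//.
by apply/measurable_EFinP; exact: continuous_measurable_fun.
Qed.

Lemma continuous_mul_fun (f g : R -> R) : continuous f -> continuous g ->
  continuous (fun t => f t * g t).
Proof. by move=> cf cg t; apply: cvgM; [exact: cf|exact: cg]. Qed.

Lemma continuous_affine a b : continuous (fun t : R => a * t + b).
Proof.
move=> t; apply: cvgD; last exact: cvg_cst.
by apply: cvgM; [exact: cvg_cst|exact: cvg_id].
Qed.

Lemma continuous_comp_affine F a b : continuous F ->
  continuous (fun t => F (a * t + b)).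
Proof.
move=> cF t; apply: (@continuous_comp _ _ _ (fun t => a * t + b) F).
  exact: continuous_affine.
exact: cF.
Qed.

Lemma ge0_gauss_opp F : continuous F -> (forall t, 0 <= F t) ->
  (\int[gam]_t (F (- t))%:E = \int[gam]_t (F t)%:E)%E.
Proof.
move=> cF F0.
have cFN : continuous (fun t => F (- t)).
  by move=> t; apply: (@continuous_comp _ _ _ -%R F); [exact: opp_continuous|exact: cF].
rewrite !ge0_gauss_continuous// [RHS]ge0_integral_opp.
- by apply: eq_integral => t _; rewrite !stdnormal_pdfE sqrrN.
- by apply: continuous_mul_fun => //; exact: continuous_pdf.
- by move=> t; rewrite mulr_ge0// normal_pdf_ge0.
Qed.

(** After translating the right-hand side by [a], completing the square gives [phi (t + a) * expR (a
    * (t + a) - a ^+ 2 / 2) = phi t]. This tilt is the source of the likelihood weights in the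
    Nishimori identities. *)
Lemma ge0_cameron_martin F a : continuous F -> (forall t, 0 <= F t) ->
  (\int[gam]_t (F (t + a))%:E =
   \int[gam]_t (F t * expR (a * t - a ^+ 2 / 2))%:E)%E.
Proof.
move=> cF F0.
have cFa : continuous (fun t => F (t + a)).
  rewrite (_ : (fun t => _) = (fun t => F (1 * t + a))).
    exact: continuous_comp_affine.
  by apply/funext => t; rewrite mul1r.
have cE : continuous (fun t => expR (a * t - a ^+ 2 / 2)).
  exact: (@continuous_comp_affine expR a (- (a ^+ 2 / 2)) (@continuous_expR R)).
rewrite !ge0_gauss_continuous//; first last.
- by move=> t; rewrite mulr_ge0// expR_ge0.
- exact: continuous_mul_fun.
rewrite [RHS](@ge0_integral_affine 1 a)//; first last.
- by move=> t; rewrite !mulr_ge0 ?expR_ge0 ?normal_pdf_ge0.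
- by apply: continuous_mul_fun; [exact: continuous_mul_fun|exact: continuous_pdf].
apply: eq_integral => t _; congr EFin.
rewrite !mul1r -mulrA; congr (_ * _).
rewrite !stdnormal_pdfE mulrCA; congr (_ * _).
by rewrite -expRD; congr expR; field.
Qed.

(** For fixed [t], the substitution [a * s + b * t = c * r] makes [F] depend on [r] alone; Tonelli
    then allows [t] to be integrated out first. *)
Lemma ge0_gauss_rotation F a b c : 0 < a -> 0 < b -> 0 < c ->
  c ^+ 2 = a ^+ 2 + b ^+ 2 -> continuous F -> (forall t, 0 <= F t) ->
  (\int[gam]_t \int[gam]_s (F (a * s + b * t))%:E =
   \int[gam]_t (F (c * t))%:E)%E.
Proof.
move=> a0 b0 c0 cab cF F0.
(* Density at [r] of [(a * s + b * t) / c] for fixed [t] and standard normal [s]. *)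
pose k r t : R := c / a * phi ((c * r - b * t) / a).
have k0 r t : 0 <= k r t.
  by rewrite /k mulr_ge0 ?normal_pdf_ge0// ltW// divr_gt0.
have cphi := continuous_pdf.
have inner t : (\int[gam]_s (F (a * s + b * t))%:E =
    \int[mu]_r (F (c * r) * k r t)%:E)%E.
  rewrite ge0_gauss_continuous//; last exact: continuous_comp_affine.
  rewrite (@ge0_integral_affine (c / a) (- (b * t / a))); first last.
  - by move=> s; rewrite mulr_ge0// normal_pdf_ge0.
  - by apply: continuous_mul_fun => //; exact: continuous_comp_affine.
  - by rewrite divr_gt0.
  apply: eq_integral => r _; congr EFin.
  rewrite mulrCA; congr (F _ * (_ * phi _)).
    by field; rewrite gt_eqF.
  by field; rewrite gt_eqF.
have mphi : measurable_fun [set: R] phi by exact: measurable_normal_pdf.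
have cFc : continuous (fun r => F (c * r)).
  rewrite (_ : (fun r => _) = (fun r => F (c * r + 0))).
    exact: continuous_comp_affine.
  by apply/funext => t; rewrite addr0.
have mFc : measurable_fun [set: R] (fun r => F (c * r)).
  exact: continuous_measurable_fun.
have mk : measurable_fun [set: R * R] (fun z : R * R => (F (c * z.2) * k z.2 z.1)%:E).
  apply/measurable_EFinP; apply: measurable_funM.
    exact: (measurableT_comp mFc).
  apply: measurable_funM => //; apply: (measurableT_comp mphi).
  by apply: measurable_funM => //; apply: measurable_funB; apply: measurable_funM.
have mkphi : measurable_fun [set: R * R]
    (fun z : R * R => (F (c * z.2) * k z.2 z.1 * phi z.1)%:E).
  apply/measurable_EFinP; apply: measurable_funM; first exact/measurable_EFinP.
  exact: (measurableT_comp mphi).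
transitivity (\int[mu]_t \int[mu]_r (F (c * r) * k r t * phi t)%:E)%E.
  under eq_integral do rewrite inner.
  rewrite ge0_integral_normal_prob; first last.
  - by move=> t; apply: integral_ge0 => s _; rewrite lee_fin mulr_ge0.
  - apply: (@measurable_fun_fubini_tonelli_F _ _ _ _ _ mu _ mk) => z.
    by rewrite lee_fin mulr_ge0.
  apply: eq_integral => t _; rewrite -ge0_integralZr//.
  - exact: measurableT_comp mk (measurable_pair1 t).
  - by move=> r _; rewrite lee_fin mulr_ge0.
  - by rewrite lee_fin normal_pdf_ge0.
rewrite (@fubini_tonelli _ _ _ _ _ mu mu _ mkphi); last first.
  move=> z; rewrite lee_fin; apply: mulr_ge0; last exact: normal_pdf_ge0.
  exact: mulr_ge0.
rewrite ge0_gauss_continuous//.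
apply: eq_integral => r _ /=.
(* The joint density of [r] and [t] factors the other way round: [r] is standard normal and, given
   [r], [t] is normal with mean [b * r / c] and deviation [a / c], so the integral over [t] is 1. *)
have kE t : k r t * phi t = phi r * normal_pdf (b * r / c) (a / c) t.
  have ac0 : a / c != 0 by rewrite gt_eqF// divr_gt0.
  have peakE : normal_peak (a / c) = c / a * normal_peak 1.
    rewrite /normal_peak expr1n mul1r -mulrnAr sqrtrM ?sqr_ge0// sqrtr_sqr.
    by rewrite gtr0_norm ?divr_gt0// invfM invf_div.
  rewrite /k !stdnormal_pdfE normal_pdfE// /normal_fun peakE.
  rewrite [LHS](_ : _ = c / a * normal_peak 1 * normal_peak 1 *
    (expR (- ((c * r - b * t) / a) ^+ 2 / 2) * expR (- t ^+ 2 / 2))); last by ring.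
  rewrite [RHS](_ : _ = c / a * normal_peak 1 * normal_peak 1 *
    (expR (- r ^+ 2 / 2) * expR (- (t - b * r / c) ^+ 2 / ((a / c) ^+ 2 *+ 2)))); last by ring.
  rewrite -!expRD; congr (_ * expR _).
  have -> : (a / c) ^+ 2 *+ 2 = a ^+ 2 / c ^+ 2 * 2 by field; rewrite gt_eqF.
  apply/eqP; rewrite -subr_eq0; apply/eqP.
  (* The two exponents differ by a multiple of [c ^+ 2 - a ^+ 2 - b ^+ 2], which vanishes by
     [cab]. *)
  transitivity ((c ^+ 2 - a ^+ 2 - b ^+ 2) * (r ^+ 2 - t ^+ 2) / (- 2 * a ^+ 2) : R).
    by field; rewrite !gt_eqF.
  by rewrite cab addrAC addrK subrr !mul0r.
under eq_integral => t _.
  rewrite -mulrA kE mulrA EFinM; over.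
rewrite /= ge0_integralZl//.
- by rewrite integral_normal_pdf mule1.
- by apply/measurable_EFinP; exact: measurable_normal_pdf.
- by move=> t _; rewrite lee_fin normal_pdf_ge0.
- by rewrite lee_fin mulr_ge0 ?normal_pdf_ge0.
Qed.

End Gaussian.

(** * Real-valued Gaussian means of functions of at most exponential growth *)

Definition gmean {R : realType} (F : R -> R) : R :=
  (\int[normal_prob 0 1]_t F t)%R.

Section GaussianMean.
Set Implicit Arguments.
Unset Strict Implicit.
Import numFieldNormedType.Exports.
Local Open Scope classical_set_scope.
Context {R : realType}.
Implicit Types (F G : R -> R) (a b c t : R).

Local Notation gam := (@normal_prob R 0 1).

(** Continuity provides measurability and the bound provides integrability. Exponential rather than
    polynomial growth makes the class stable under multiplication by the Cameron-Martin tilts. *)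
Definition exp_growth F := continuous F /\
  exists C c, [/\ 0 <= C, 0 <= c & forall t, `|F t| <= C * expR (c * `|t|)].

(** Translating the constant function [expR (a ^+ 2 / 2)] changes nothing, and its tilt is exactly
    [expR (a * t)]. *)
Lemma gauss_exp a : (\int[gam]_t (expR (a * t))%:E = (expR (a ^+ 2 / 2))%:E)%E.
Proof.
have := @ge0_cameron_martin R (fun=> expR (a ^+ 2 / 2)) a.
rewrite integral_cst// [X in (_ * X)%E](@probability_setT _ _ _ gam) mule1 => ->; last first.
- by move=> t; rewrite expR_ge0.
- exact: cst_continuous.
by apply: eq_integral => t _; rewrite -expRD; congr ((expR _)%:E); ring.
Qed.

Lemma continuous_exp_affine a b : continuous (fun t : R => expR (a * t + b)).
Proof. exact: (@continuous_comp_affine R expR a b (@continuous_expR R)). Qed.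

Lemma continuous_normr : continuous (fun t : R => `|t|).
Proof. by move=> t; exact: (@norm_continuous R R^o). Qed.

Lemma integrable_expR a : gam.-integrable setT (EFin \o (fun t => expR (a * t))).
Proof.
apply/integrableP; split.
  apply/measurable_EFinP; apply: continuous_measurable_fun.
  by have := @continuous_exp_affine a 0; under eq_fun do rewrite addr0.
under eq_integral => t _ do rewrite /= ger0_norm ?expR_ge0//.
by rewrite gauss_exp ltry.
Qed.

Lemma exp_growth_integrable F : exp_growth F -> gam.-integrable setT (EFin \o F).
Proof.
move=> [cF [C [c [C0 c0 FC]]]].
(* The dominating function comes from [expR (c * |t|) <= expR (c * t) + expR (- c * t)]. *)
apply: (@le_integrable _ _ _ gam setT measurableT (EFin \o F)
  (fun t => (C * expR (c * t))%:E + (C * expR (- c * t))%:E)%E) => //.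
- by apply/measurable_EFinP; exact: continuous_measurable_fun.
- move=> t _ /=; rewrite lee_fin (le_trans (FC t))// [leRHS]ger0_norm; last first.
    by rewrite addr_ge0// mulr_ge0// expR_ge0.
  rewrite -mulrDr ler_wpM2l//; have [t0|t0] := leP 0 t.
    by rewrite ger0_norm// lerDl expR_ge0.
  by rewrite ltr0_norm// mulrN mulNr lerDr expR_ge0.
- by apply: integrableD => //;
    [exact: (integrableZl measurableT C (integrable_expR c))
    |exact: (integrableZl measurableT C (integrable_expR (- c)))].
Qed.

Lemma exp_growth_cst a : exp_growth (fun=> a).
Proof.
split; first exact: cst_continuous.
by exists `|a|, 0; split=> // t; rewrite mul0r expR0 mulr1.
Qed.

Lemma exp_growthD F G : exp_growth F -> exp_growth G ->
  exp_growth (fun t => F t + G t).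
Proof.
move=> [cF [C [c [C0 c0 FC]]]] [cG [D [d [D0 d0 GD]]]]; split.
  by move=> t; apply: cvgD; [exact: cF|exact: cG].
exists (C + D), (c + d); split; [exact: addr_ge0|exact: addr_ge0|move=> t].
rewrite (le_trans (ler_normD _ _))// mulrDl lerD//.
  rewrite (le_trans (FC t))// ler_wpM2l// ler_expR ler_wpM2r//; lra.
rewrite (le_trans (GD t))// ler_wpM2l// ler_expR ler_wpM2r//; lra.
Qed.

Lemma exp_growthM F G : exp_growth F -> exp_growth G ->
  exp_growth (fun t => F t * G t).
Proof.
move=> [cF [C [c [C0 c0 FC]]]] [cG [D [d [D0 d0 GD]]]]; split.
  exact: continuous_mul_fun.
exists (C * D), (c + d); split; [exact: mulr_ge0|exact: addr_ge0|move=> t].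
by rewrite normrM mulrDl expRD mulrACA ler_pM.
Qed.

Lemma exp_growthN F : exp_growth F -> exp_growth (fun t => - F t).
Proof.
move=> gF; rewrite (_ : (fun t => _) = (fun t => -1 * F t)).
  exact: exp_growthM (exp_growth_cst _) gF.
by apply/funext => t; rewrite mulN1r.
Qed.

Lemma exp_growthB F G : exp_growth F -> exp_growth G ->
  exp_growth (fun t => F t - G t).
Proof. by move=> gF gG; apply: exp_growthD => //; exact: exp_growthN. Qed.

Lemma exp_growth_norm F : exp_growth F -> exp_growth (fun t => `|F t|).
Proof.
move=> [cF [C [c [C0 c0 FC]]]]; split.
  by move=> t; apply: (@continuous_comp _ _ _ F Num.norm); [exact: cF|exact: continuous_normr].
by exists C, c; split=> // t; rewrite normr_id.
Qed.

Lemma exp_growthX F n : exp_growth F -> exp_growth (fun t => F t ^+ n).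
Proof.
move=> gF; elim: n => [|n IHn]; first exact: exp_growth_cst.
by under eq_fun do rewrite exprS; exact: exp_growthM.
Qed.

Definition lipschitzR (L : R) F := forall s t, `|F s - F t| <= L * `|s - t|.

Lemma lipschitzR_continuous L F : lipschitzR L F -> continuous F.
Proof.
move=> FL t; apply/cvgrPdist_le => e e0.
have L0 : 0 < `|L| + 1 by rewrite ltr_pwDr.
near=> s.
rewrite (le_trans (FL _ _))// (@le_trans _ _ ((`|L| + 1) * `|t - s|))//.
  by rewrite ler_wpM2r// (le_trans (ler_norm _))// lerDl.
rewrite mulrC -ler_pdivlMr//; near: s.
by apply: cvgr_dist_le; [exact: cvg_id|rewrite divr_gt0].
Unshelve. all: by end_near. Qed.

Lemma exp_growth_id : exp_growth (fun t => t).
Proof.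
split; first by move=> t; exact: cvg_id.
exists 1, 1; split=> // t; rewrite !mul1r.
by rewrite (le_trans _ (expR_ge1Dx _))// lerDr.
Qed.

Lemma exp_growth_lipschitz L F : lipschitzR L F -> exp_growth F.
Proof.
move=> FL; split; first exact: lipschitzR_continuous FL.
exists (`|F 0| + `|L|), 1; split=> //.
move=> t; rewrite mul1r mulrDl.
have -> : F t = F 0 + (F t - F 0) by rewrite addrC subrK.
rewrite (le_trans (ler_normD _ _))// lerD//.
  rewrite ler_peMr// -expR0 ler_expR//.
rewrite (le_trans (FL _ _))// subr0 ler_pM//.
- by have := FL 1 0; rewrite subr0 normr1 mulr1; exact: le_trans.
- exact: ler_norm.
- by rewrite (le_trans _ (expR_ge1Dx _))// lerDr.
Qed.

Lemma exp_growth_expR a b : exp_growth (fun t => expR (a * t + b)).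
Proof.
split; first exact: continuous_exp_affine.
exists (expR b), `|a|; split => //.
move=> t; rewrite ger0_norm ?expR_ge0// -expRD ler_expR addrC lerD2l.
by rewrite -normrM ler_norm.
Qed.

Lemma exp_growth_expR_norm a : 0 <= a -> exp_growth (fun t => expR (a * `|t|)).
Proof.
move=> a0; split; last first.
  by exists 1, a; split => // t; rewrite mul1r ger0_norm ?expR_ge0.
move=> t; apply: (@continuous_comp _ _ _ (fun t => a * `|t|) expR); last first.
  exact: continuous_expR.
by apply: cvgM; [exact: cvg_cst|exact: continuous_normr].
Qed.

Lemma exp_growth_comp_affine F a b : exp_growth F ->
  exp_growth (fun t => F (a * t + b)).
Proof.
move=> [cF [C [c [C0 c0 FC]]]]; split; first exact: continuous_comp_affine.
exists (C * expR (c * `|b|)), (c * `|a|); split.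
- by rewrite mulr_ge0// expR_ge0.
- exact: mulr_ge0.
move=> t; rewrite (le_trans (FC _))// -mulrA ler_wpM2l// -expRD ler_expR.
rewrite -mulrA -mulrDr ler_wpM2l// -normrM addrC.
exact: ler_normD.
Qed.

Lemma exp_growth_opp F : exp_growth F -> exp_growth (fun t => F (- t)).
Proof.
move=> /(@exp_growth_comp_affine _ (-1) 0).
by under eq_fun do rewrite addr0 mulN1r.
Qed.

Lemma exp_growth_shift F a : exp_growth F -> exp_growth (fun t => F (t + a)).
Proof.
move=> /(@exp_growth_comp_affine _ 1 a).
by under eq_fun do rewrite mul1r.
Qed.

Lemma exp_growth_scale F a : exp_growth F -> exp_growth (fun t => F (a * t)).
Proof.
move=> /(@exp_growth_comp_affine _ a 0).
by under eq_fun do rewrite addr0.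
Qed.

Lemma EFin_gmean F : exp_growth F -> (\int[gam]_t (F t)%:E = (gmean F)%:E)%E.
Proof.
move=> /exp_growth_integrable iF; rewrite /gmean /Rintegral fineK//.
exact: integrable_fin_num.
Qed.

Lemma gmean_cst a : gmean (fun=> a) = a.
Proof.
rewrite /gmean Rintegral_cst//.
by rewrite [X in fine X](@probability_setT _ _ _ gam) mulr1.
Qed.

Lemma gmeanD F G : exp_growth F -> exp_growth G ->
  gmean (fun t => F t + G t) = gmean F + gmean G.
Proof. by move=> gF gG; rewrite /gmean RintegralD//; exact: exp_growth_integrable. Qed.

Lemma gmeanB F G : exp_growth F -> exp_growth G ->
  gmean (fun t => F t - G t) = gmean F - gmean G.
Proof. by move=> gF gG; rewrite /gmean RintegralB//; exact: exp_growth_integrable. Qed.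

Lemma gmeanZ a F : exp_growth F -> gmean (fun t => a * F t) = a * gmean F.
Proof. by move=> gF; rewrite /gmean RintegralZl//; exact: exp_growth_integrable. Qed.

Lemma ler_gmean F G : exp_growth F -> exp_growth G -> (forall t, F t <= G t) ->
  gmean F <= gmean G.
Proof. by move=> gF gG FG; apply: le_Rintegral => //; exact: exp_growth_integrable. Qed.

Lemma ler_norm_gmean F G : exp_growth F -> exp_growth G ->
  (forall t, `|F t| <= G t) -> `|gmean F| <= gmean G.
Proof.
move=> gF gG FG; apply: le_trans (le_normr_Rintegral _ _) _ => //.
  exact: exp_growth_integrable.
by apply: ler_gmean => //; exact: exp_growth_norm.
Qed.

Lemma ler_dist_gmean F G H : exp_growth F -> exp_growth G -> exp_growth H ->
  (forall t, `|F t - G t| <= H t) -> `|gmean F - gmean G| <= gmean H.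
Proof.
move=> gF gG gH FGH; rewrite -gmeanB//; apply: ler_norm_gmean => //.
exact: exp_growthB.
Qed.

(** Writing [F] as [(F + M) - M] with both terms nonnegative carries the identities proved for
    nonnegative integrands over to all of [exp_growth]. *)
Lemma exp_growth_majorant F : exp_growth F ->
  exists M, [/\ exp_growth M, forall t, 0 <= M t & forall t, 0 <= F t + M t].
Proof.
move=> [_ [C [c [C0 c0 FC]]]]; exists (fun t => C * expR (c * `|t|)); split.
- by apply: exp_growthM; [exact: exp_growth_cst|exact: exp_growth_expR_norm].
- by move=> t; rewrite mulr_ge0// expR_ge0.
- by move=> t; rewrite addrC -lerBlDr sub0r (le_trans _ (FC t))// -normrN ler_norm.
Qed.

Lemma gmean_opp F : exp_growth F -> gmean (fun t => F (- t)) = gmean F.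
Proof.
have pos G : exp_growth G -> (forall t, 0 <= G t) -> gmean (fun t => G (- t)) = gmean G.
  by move=> [cG _] G0; rewrite /gmean /Rintegral ge0_gauss_opp.
move=> gF; have [M [gM M0 FM0]] := exp_growth_majorant gF.
have := pos _ (exp_growthD gF gM) FM0.
rewrite gmeanD; [|exact: exp_growth_opp..].
by rewrite gmeanD// (pos _ gM M0) => /addIr.
Qed.

Lemma gmean_shift F a : exp_growth F ->
  gmean (fun t => F (t + a)) = gmean (fun t => F t * expR (a * t - a ^+ 2 / 2)).
Proof.
have pos G : exp_growth G -> (forall t, 0 <= G t) ->
    gmean (fun t => G (t + a)) = gmean (fun t => G t * expR (a * t - a ^+ 2 / 2)).
  by move=> [cG _] G0; rewrite /gmean /Rintegral ge0_cameron_martin.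
move=> gF; have [M [gM M0 FM0]] := exp_growth_majorant gF.
have gE := exp_growth_expR a (- (a ^+ 2 / 2)).
have := pos _ (exp_growthD gF gM) FM0.
rewrite gmeanD; [|exact: exp_growth_shift..].
under [in RHS]eq_fun do rewrite mulrDl.
rewrite gmeanD; [|exact: exp_growthM..].
by rewrite (pos _ gM M0) => /addIr.
Qed.

Lemma gmean_expR a : gmean (fun t => expR (a * t)) = expR (a ^+ 2 / 2).
Proof. by rewrite /gmean /Rintegral gauss_exp. Qed.

End GaussianMean.

(** * Second order Taylor expansion with cubic remainder *)

Section Taylor.
Set Implicit Arguments.
Unset Strict Implicit.
Import numFieldNormedType.Exports.
Context {R : realType}.
Implicit Types (F : R -> R).

Lemma MVT_at0 F dF (u : R) : (forall x : R, is_derive x 1 F (dF x)) ->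
  exists2 v, `|v| <= `|u| & F u - F 0 = dF v * u.
Proof.
move=> FdF.
have cF A : {within A, continuous F}%classic.
  apply: continuous_subspaceT => x.
  by apply/differentiable_continuous/derivable1_diffP; case: (FdF x).
have [u0|u0] := leP 0 u.
  have [v] := MVT_segment u0 (fun x _ => FdF x) (cF _).
  rewrite in_itv/= subr0 => /andP[v0 vu] ->; exists v => //.
  by rewrite !ger0_norm.
have [v] := MVT_segment (ltW u0) (fun x _ => FdF x) (cF _).
rewrite in_itv/= sub0r => /andP[uv v0] FE; exists v.
  by rewrite (ltr0_norm u0) ler0_norm// lerN2.
by rewrite -opprB FE mulrN opprK.
Qed.

(** The mean value theorem is applied to [F1] and then to [F], each minus its Taylor polynomial, so
    a Lipschitz bound on [F2] at 0 replaces a third derivative and the constant is [C] rather than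
    [C / 6]. The bound is asked only up to [|u|], so that [C] may depend on [u], as it does for the
    exponential. *)
Lemma taylor2_bound F F1 F2 (C u : R) : 0 <= C ->
  (forall x : R, is_derive x 1 F (F1 x)) -> (forall x : R, is_derive x 1 F1 (F2 x)) ->
  (forall v, `|v| <= `|u| -> `|F2 v - F2 0| <= C * `|v|) ->
  `|F u - F 0 - u * F1 0 - u ^+ 2 * (F2 0 / 2)| <= C * `|u| ^+ 3.
Proof.
move=> C0 dF dF1 F2C.
have first v : `|v| <= `|u| -> `|F1 v - F1 0 - v * F2 0| <= C * `|v| ^+ 2.
  move=> vu.
  have dG (x : R) : is_derive x 1 (fun x : R => F1 x - x * F2 0) (F2 x - F2 0).
    have := dF1 x => ?.
    by apply: is_derive_eq; rewrite scaler0 add0r /GRing.scale/= mulr1.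
  have [w wv] := MVT_at0 v dG; rewrite mul0r subr0 addrAC => ->.
  rewrite normrM expr2 mulrA ler_wpM2r//.
  rewrite (le_trans (F2C _ (le_trans wv vu)))//.
  by rewrite ler_wpM2l.
have dG (x : R) : is_derive x 1 (fun x : R => F x - x * F1 0 - x ^+ 2 * (F2 0 / 2))
    (F1 x - F1 0 - x * F2 0).
  have := dF x => ?.
  by apply: is_derive_eq; rewrite !scaler0 !add0r /GRing.scale/=; field.
have [w wu] := MVT_at0 u dG.
rewrite mul0r expr0n/= mul0r !subr0.
rewrite [X in `|X|](_ : _ = F u - u * F1 0 - u ^+ 2 * (F2 0 / 2) - F 0); last by ring.
move=> ->; rewrite normrM exprSr mulrA ler_wpM2r//.
rewrite (le_trans (first _ wu))// ler_wpM2l//.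
by rewrite ler_pXn2r// nnegrE.
Qed.

Lemma expR_taylor2 (u : R) :
  `|expR u - 1 - u - u ^+ 2 / 2| <= expR `|u| * `|u| ^+ 3.
Proof.
have dE (x : R) : is_derive x 1 (@expR R) (expR x) by exact: is_derive_expR.
have := @taylor2_bound expR expR expR (expR `|u|) u (expR_ge0 _) dE dE.
rewrite expR0 mulr1 mul1r; apply => v vu.
have [w wv] := MVT_at0 v dE; rewrite expR0 => ->.
rewrite normrM ler_wpM2r// ger0_norm ?expR_ge0// ler_expR.
by rewrite (le_trans (ler_norm _))// (le_trans wv).
Qed.

End Taylor.

(** * First and second moments of the standard normal law *)

Section GaussianMoments.
Set Implicit Arguments.
Unset Strict Implicit.
Import numFieldNormedType.Exports.
Local Open Scope classical_set_scope.
Context {R : realType}.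
Implicit Types (F G : R -> R) (a b c t : R).

Local Notation gam := (@normal_prob R 0 1).

Lemma gmean_id : gmean (fun t : R => t) = 0.
Proof.
have := gmean_opp (@exp_growth_id R).
have -> : (fun t : R => - t) = (fun t => -1 * t) by apply/funext => t; rewrite mulN1r.
rewrite gmeanZ; [lra|exact: exp_growth_id].
Qed.

Lemma exp_growth_cube : exp_growth (fun t : R => (`|t| + 1) ^+ 3).
Proof.
apply/exp_growthX/exp_growthD; last exact: exp_growth_cst.
exact/exp_growth_norm/exp_growth_id.
Qed.

(* Second order expansion at [a = 0] of the moment generating function. *)
Lemma gmean_sqr : gmean (fun t : R => t ^+ 2) = 1.
Proof.
have gid := @exp_growth_id R.
have gsqr : exp_growth (fun t : R => t ^+ 2) by exact: exp_growthX.
pose M (t : R) := expR (1 * `|t|) * `|t| ^+ 3.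
have gM : exp_growth M.
  apply: exp_growthM; first exact: exp_growth_expR_norm.
  exact/exp_growthX/exp_growth_norm.
pose v := gmean (fun t : R => t ^+ 2).
have bound a : 0 < a -> a <= 1 -> `|v - 1| <= a * (2 * gmean M + expR 1).
  move=> a0 a1.
  have gE : exp_growth (fun t => expR (a * t)).
    by have := @exp_growth_expR R a 0; under eq_fun do rewrite addr0.
  have g1 := @exp_growth_cst R 1.
  have g2 : exp_growth (fun t => a * t) by apply: exp_growthM => //; exact: exp_growth_cst.
  have g3 : exp_growth (fun t => a ^+ 2 / 2 * t ^+ 2).
    by apply: exp_growthM => //; exact: exp_growth_cst.
  have gP := exp_growthD (exp_growthD g1 g2) g3.
  have : `|gmean (fun t => expR (a * t)) - gmean (fun t => 1 + a * t + a ^+ 2 / 2 * t ^+ 2)|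
       <= gmean (fun t => a ^+ 3 * M t).
    apply: ler_dist_gmean => //.
      by apply: exp_growthM => //; exact: exp_growth_cst.
    move=> t; have := expR_taylor2 (a * t).
    rewrite [X in `|X|](_ : _ = expR (a * t) - (1 + a * t + a ^+ 2 / 2 * t ^+ 2)); last by field.
    move=> /le_trans; apply; rewrite normrM gtr0_norm// exprMn mulrCA.
    apply: ler_wpM2l; first by rewrite exprn_ge0// ltW.
    apply: ler_wpM2r; first exact: exprn_ge0.
    by rewrite ler_expR ler_wpM2r.
  rewrite gmean_expR gmeanZ// (gmeanD (exp_growthD g1 g2) g3) (gmeanD g1 g2).
  rewrite gmean_cst !gmeanZ// gmean_id mulr0 addr0 -/v => H1.
  have := expR_taylor2 (a ^+ 2 / 2).
  have a20 : 0 <= a ^+ 2 / 2 by rewrite divr_ge0 ?sqr_ge0.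
  have a21 : a ^+ 2 / 2 <= 1 by nra.
  rewrite (ger0_norm a20) => H2.
  have e1 : expR (a ^+ 2 / 2) <= expR 1 by rewrite ler_expR.
  have e1_ge1 : 1 <= expR (1 : R) by rewrite -[leLHS]expR0 ler_expR.
  set y := a ^+ 2 / 2 in H1 H2 a20 a21 e1 *.
  have yy : y ^+ 2 <= a ^+ 3 / 4 by rewrite /y; nra.
  have y3 : y ^+ 3 <= a ^+ 3 / 8.
    have -> : y ^+ 3 = a ^+ 3 / 8 * a ^+ 3 by rewrite /y; field.
    rewrite ler_piMr ?exprn_ile1// ?(ltW a0)//.
    by rewrite divr_ge0// exprn_ge0// ltW.
  have H3 : expR y * y ^+ 3 <= expR 1 * (a ^+ 3 / 8).
    by apply: ler_pM; rewrite ?expR_ge0 ?exprn_ge0.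
  have a3 : 0 <= a ^+ 3 by rewrite exprn_ge0// ltW.
  have H4 : y * `|v - 1| <= a ^+ 3 * (gmean M + expR 1 / 2).
    rewrite -(ger0_norm a20) -normrM.
    have -> : y * (v - 1) = (expR y - 1 - y - y ^+ 2 / 2) -
       (expR y - (1 + y * v)) + y ^+ 2 / 2 by ring.
    rewrite (le_trans (ler_normD _ _))// (ger0_norm (_ : 0 <= y ^+ 2 / 2)); last by nra.
    have := ler_normB (expR y - 1 - y - y ^+ 2 / 2) (expR y - (1 + y * v)).
    have := ler_wpM2l a3 e1_ge1; rewrite mulr1.
    lra.
  have a2 : 0 < a ^+ 2 by rewrite exprn_gt0.
  rewrite -(ler_pM2l a2); move: H4; rewrite /y.
  have -> : a ^+ 2 * (a * (2 * gmean M + expR 1)) = 2 * (a ^+ 3 * (gmean M + expR 1 / 2)) by field.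
  lra.
apply/eqP; rewrite -subr_eq0 -normr_le0; apply/ler_addgt0Pr => e e0; rewrite add0r.
pose K := 2 * gmean M + expR 1.
have K0 : 0 < K.
  by rewrite ltr_wpDl ?expR_gt0// mulr_ge0// Rintegral_ge0// => t _; rewrite /M mulr_ge0// expR_ge0.
have a0 : 0 < Num.min 1 (e / K) by rewrite lt_min ltr01 divr_gt0.
have := bound _ a0; rewrite ge_min lexx => /(_ isT) /le_trans; apply.
by rewrite -ler_pdivlMr// ge_min lexx orbT.
Qed.

Lemma gmean_affine a b : gmean (fun t => a * t + b) = b.
Proof.
have gid := @exp_growth_id R.
rewrite gmeanD; [|by apply: exp_growthM => //; exact: exp_growth_cst|exact: exp_growth_cst].
by rewrite gmeanZ// gmean_id mulr0 add0r gmean_cst.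
Qed.

Lemma gmean_affine_sqr a b : gmean (fun t => (a * t + b) ^+ 2) = a ^+ 2 + b ^+ 2.
Proof.
have gid := @exp_growth_id R.
have gsqr : exp_growth (fun t : R => t ^+ 2) by exact: exp_growthX.
rewrite (_ : (fun t => _) = (fun t => a ^+ 2 * t ^+ 2 + (2 * a * b * t + b ^+ 2))); last first.
  by apply/funext => t; ring.
rewrite gmeanD.
- by rewrite gmeanZ// gmean_sqr mulr1 gmean_affine.
- by apply: exp_growthM => //; exact: exp_growth_cst.
- by apply: exp_growthD; [apply: exp_growthM => //|]; exact: exp_growth_cst.
Qed.

End GaussianMoments.

(** * Two independent Gaussians: rotation and exchange of means for Lipschitz functions *)

Section GaussianPlane.
Set Implicit Arguments.
Unset Strict Implicit.
Import numFieldNormedType.Exports.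
Local Open Scope classical_set_scope.
Context {R : realType}.
Implicit Types (F G : R -> R) (a b c t : R).

Local Notation gam := (@normal_prob R 0 1).

Lemma lipschitzR_ge0 L F : lipschitzR L F -> 0 <= L.
Proof. by move=> /(_ 1 0); rewrite subr0 normr1 mulr1; exact: le_trans. Qed.

Lemma lipschitzR_affine L F a b : lipschitzR L F ->
  lipschitzR (L * `|a|) (fun t => F (a * t + b)).
Proof.
move=> FL s t; rewrite (le_trans (FL _ _))// -mulrA -normrM.
by rewrite (_ : _ - _ = a * (s - t)) //; ring.
Qed.

Lemma lipschitzR_gmean (H : R -> R -> R) (L : R) :
  (forall s, exp_growth (H s)) ->
  (forall s s' t, `|H s t - H s' t| <= L * `|s - s'|) ->
  lipschitzR L (fun s => gmean (H s)).
Proof.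
move=> gH HL s s'; rewrite -(gmean_cst (L * _)).
by apply: ler_dist_gmean => //; exact: exp_growth_cst.
Qed.

Lemma gmean_rotation L F a b c : 0 < a -> 0 < b -> 0 < c ->
  c ^+ 2 = a ^+ 2 + b ^+ 2 -> lipschitzR L F ->
  gmean (fun t => gmean (fun s => F (a * s + b * t))) = gmean (fun t => F (c * t)).
Proof.
move=> a0 b0 c0 cab.
have inner G K t : lipschitzR K G -> exp_growth (fun s => G (a * s + b * t)).
  by move=> GK; apply: exp_growth_comp_affine; exact: exp_growth_lipschitz GK.
have outer G K : lipschitzR K G -> exp_growth (fun t => gmean (fun s => G (a * s + b * t))).
  move=> GK; apply: (@exp_growth_lipschitz _ (K * `|b|)); apply: (@lipschitzR_gmean (fun t s => G (a * s + b * t))) => [t|t t' s].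
    exact: inner GK.
  rewrite (le_trans (GK _ _))// -mulrA -normrM.
  by rewrite (_ : _ - _ = b * (t - t'))//; ring.
have pos G K : lipschitzR K G -> (forall t, 0 <= G t) ->
    gmean (fun t => gmean (fun s => G (a * s + b * t))) = gmean (fun t => G (c * t)).
  move=> GK G0; have cG := lipschitzR_continuous GK.
  apply: EFin_inj; rewrite -!EFin_gmean; first last.
  - exact: outer GK.
  - exact: exp_growth_scale c (exp_growth_lipschitz GK).
  rewrite -(ge0_gauss_rotation a0 b0 c0 cab cG G0).
  by apply: eq_integral => t _; rewrite EFin_gmean//; exact: inner GK.
(* This majorant is itself Lipschitz, so that both [M] and [F + M] fall under [pos]. *)
move=> FL; pose M t := `|F 0| + L * `|t|.
have L0 := lipschitzR_ge0 FL.
have ML : lipschitzR L M.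
  move=> s t; rewrite /M opprD addrACA subrr add0r -mulrBr normrM (ger0_norm L0).
  by rewrite ler_wpM2l// ler_dist_dist.
have M0 t : 0 <= M t by rewrite /M addr_ge0// mulr_ge0.
have FM0 t : 0 <= F t + M t.
  rewrite -lerBlDr sub0r lerNl (le_trans (ler_norm _))// normrN /M.
  have -> : F t = F 0 + (F t - F 0) by rewrite addrC subrK.
  rewrite (le_trans (ler_normD _ _))// lerD2l.
  by have := FL t 0; rewrite subr0.
have FML : lipschitzR (L + L) (fun t => F t + M t).
  by move=> s t; rewrite opprD addrACA (le_trans (ler_normD _ _))// mulrDl lerD.
have := pos _ _ FML FM0.
under eq_fun => t do rewrite (gmeanD (inner _ _ _ FL) (inner _ _ _ ML)).
rewrite (gmeanD (outer _ _ FL) (outer _ _ ML)) (pos _ _ ML M0).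
rewrite gmeanD; first exact: addIr.
- exact: exp_growth_scale c (exp_growth_lipschitz FL).
- exact: exp_growth_scale c (exp_growth_lipschitz ML).
Qed.

Lemma measurable_lipschitz2 (L : R) (H : R -> R -> R) :
  (forall s s' t, `|H s t - H s' t| <= L * `|s - s'|) ->
  (forall s t t', `|H s t - H s t'| <= L * `|t - t'|) ->
  measurable_fun [set: R * R] (fun z : R * R => H z.1 z.2).
Proof.
(* [H s t] is the supremum over rational [q] of [H q t - L |s - q|]. *)
move=> H1 H2 mT; apply: (measurability _ (RGenOInfty.measurableE R)) => //.
move=> _ [_ [x ->] <-].
have L0 : 0 <= L by have := H1 1 0 0; rewrite subr0 normr1 mulr1; exact: le_trans.
pose h (q : rat) (z : R * R) : R := H (ratr q) z.2 - L * `|z.1 - ratr q|.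
have -> : setT `&` (fun z : R * R => H z.1 z.2) @^-1` `]x, +oo[ =
    \bigcup_(q : rat) (h q @^-1` `]x, +oo[).
  rewrite setTI; apply/seteqP; split => [[s t] /=|[s t] [q _] /=].
    rewrite in_itv/= andbT => xH.
    (* Replacing [s] by a rational within [e] costs at most [L * e] in [H] and [L * e] in the
       penalty; the [+ 1] covers [L = 0] and makes the inequality strict. *)
    pose e := (H s t - x) / (2 * L + 1).
    have e0 : 0 < e by rewrite divr_gt0 ?subr_gt0//; lra.
    have : s < s + e by rewrite ltrDl.
    move=> /rat_in_itvoo[q]; rewrite in_itv/= => /andP[sq qs].
    exists q => //; rewrite /= in_itv/= andbT /h/=.
    have := H1 s (ratr q) t; have sq' : `|s - ratr q| < e.
      by rewrite distrC gtr0_norm ?subr_gt0// ltrBlDl.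
    have He : e * (2 * L + 1) = H s t - x by rewrite /e divfK//; lra.
    move=> /(le_trans (ler_norm _)) H3; nra.
  rewrite !in_itv/= !andbT /h/= => xh; apply: lt_le_trans xh _.
  by rewrite lerBlDr addrC -lerBlDr -normrN opprB (le_trans _ (H1 _ _ t))// ler_norm.
apply: bigcupT_measurable_rat => q; rewrite -[X in measurable X]setTI.
suff : measurable_fun [set: R * R] (h q) by apply.
apply: measurable_funB.
  have mHq : measurable_fun [set: R] (H (ratr q)).
    apply: continuous_measurable_fun; apply: (@lipschitzR_continuous _ L) => t t'.
    exact: H2.
  exact: (measurableT_comp mHq).
apply: measurable_funM => //; apply: measurableT_comp => //.
exact: measurable_funB.
Qed.

(** Fubini's theorem: Lipschitz bounds in each variable give joint measurability, and also the bound
    [|H 0 0| + L * |s| + L * |t|], hence integrability over the plane. *)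
Lemma gmean_swap (L : R) (H : R -> R -> R) :
  (forall s s' t, `|H s t - H s' t| <= L * `|s - s'|) ->
  (forall s t t', `|H s t - H s t'| <= L * `|t - t'|) ->
  gmean (fun s => gmean (fun t => H s t)) = gmean (fun t => gmean (fun s => H s t)).
Proof.
move=> H1 H2.
have L0 : 0 <= L by have := H1 1 0 0; rewrite subr0 normr1 mulr1; exact: le_trans.
have g1 s : exp_growth (H s) by apply: (@exp_growth_lipschitz _ L) => t t'; exact: H2.
have g2 t : exp_growth (H^~ t) by apply: (@exp_growth_lipschitz _ L) => s s'; exact: H1.
have gg1 : exp_growth (fun s => gmean (fun t => H s t)).
  by apply: (@exp_growth_lipschitz _ L); exact: lipschitzR_gmean.
have gg2 : exp_growth (fun t => gmean (fun s => H s t)).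
  by apply: (@exp_growth_lipschitz _ L); apply: lipschitzR_gmean => // t t' s; exact: H2.
apply: EFin_inj; rewrite -!EFin_gmean//.
under eq_integral do rewrite -EFin_gmean//.
under [RHS]eq_integral do rewrite -EFin_gmean//.
have mH := measurable_lipschitz2 H1 H2.
have mHE : measurable_fun [set: R * R] (fun z : R * R => (H z.1 z.2)%:E).
  exact/measurable_EFinP.
have iH : (gam \x gam)%E.-integrable setT (fun z : R * R => (H z.1 z.2)%:E).
  apply/(integrable12ltyP gam gam mHE).
  pose M (s t : R) := `|H 0 0| + L * `|s| + L * `|t|.
  have gabs : exp_growth (fun t : R => `|t|) by exact/exp_growth_norm/exp_growth_id.
  have gLabs : exp_growth (fun t : R => L * `|t|).
    by apply: exp_growthM => //; exact: exp_growth_cst.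
  have gM s : exp_growth (M s).
    by apply: exp_growthD => //; exact: exp_growth_cst.
  have HM s t : `|H s t| <= M s t.
    have -> : H s t = H 0 0 + (H s 0 - H 0 0) + (H s t - H s 0) by ring.
    rewrite (le_trans (ler_normD _ _))// lerD//.
      rewrite (le_trans (ler_normD _ _))// lerD//.
      by have := H1 s 0 0; rewrite subr0.
    by have := H2 s t 0; rewrite subr0.
  apply: (@le_lt_trans _ _ (\int[gam]_s (gmean (M s))%:E)%E).
    apply: ge0_le_integral => //.
    - by move=> s _; apply: integral_ge0.
    - under eq_fun => s do rewrite /= (EFin_gmean (exp_growth_norm (g1 s))).
      apply/measurable_EFinP; apply: continuous_measurable_fun.
      apply: (@lipschitzR_continuous _ L); apply: lipschitzR_gmean => [s|s s' t].
        exact: exp_growth_norm.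
      exact: le_trans (ler_dist_dist _ _) (H1 _ _ _).
    - apply/measurable_EFinP; apply: continuous_measurable_fun.
      under eq_fun => s do rewrite (gmeanD (exp_growth_cst _) gLabs) gmean_cst.
      apply: (@lipschitzR_continuous _ L) => s s'.
      rewrite opprD addrACA subrr addr0 opprD addrACA subrr add0r -mulrBr normrM.
      by rewrite (ger0_norm L0) ler_wpM2l// ler_dist_dist.
    - move=> s _; rewrite /= (EFin_gmean (exp_growth_norm (g1 s))) lee_fin.
      by apply: ler_gmean => //; exact: exp_growth_norm.
  rewrite EFin_gmean ?ltry//.
  under eq_fun => s do rewrite (gmeanD (exp_growth_cst _) gLabs) gmean_cst.
  apply: exp_growthD; last exact: exp_growth_cst.
  by apply: exp_growthD => //; exact: exp_growth_cst.
exact: (Fubini iH).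
Qed.

End GaussianPlane.

(** * Averaging over Gaussian increments of finitely many couplings *)

Definition shift_at {R : realType} {I : finType} (k : I -> R) (i : I) (u : R) : I -> R :=
  fun j => k j + u * (j == i)%:R.

(** Only one-coordinate moves are tested, since [step] makes no others; averaging by [step]
    preserves the constant. *)
Definition coord_lip {R : realType} {I : finType} (L : R) (Psi : (I -> R) -> R) :=
  forall k i u, `|Psi (shift_at k i u) - Psi k| <= L * `|u|.

Definition lip {R : realType} {I : finType} (Psi : (I -> R) -> R) :=
  exists L, coord_lip L Psi.

(* Adds to the coordinate [i] a Gaussian of variance [x] and mean [x] ([sg = 1])
   or [- x] ([sg = -1]): the law of the coupling in the gauge [sg]. *)
Definition step {R : realType} {I : finType} (sg : R) (i : I) (x : R)
    (Psi : (I -> R) -> R) (k : I -> R) : R :=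
  gmean (fun t => Psi (shift_at k i (sg * (Num.sqrt x * t + x)))).

(** The coordinates are drawn in the order of [s], the head outermost, as in [gaussE_seq]; drawing
    adds to the current coupling instead of replacing it. *)
Fixpoint steps {R : realType} {I : finType} (sg w : I -> R) (s : seq I)
    (Psi : (I -> R) -> R) : (I -> R) -> R :=
  if s is i :: s' then step (sg i) i (w i) (steps sg w s' Psi) else Psi.

Section Steps.
Set Implicit Arguments.
Unset Strict Implicit.
Context {R : realType} {I : finType}.
Implicit Types (k w : I -> R) (i j : I) (Psi Phi : (I -> R) -> R) (x y : R).

Lemma shift_atD k i u v : shift_at (shift_at k i u) i v = shift_at k i (u + v).
Proof. by apply/funext => j; rewrite /shift_at mulrDl addrA. Qed.

Lemma shift_atC k i j u v : shift_at (shift_at k i u) j v = shift_at (shift_at k j v) i u.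
Proof. by apply/funext => l; rewrite /shift_at addrAC. Qed.

Lemma shift_at0 k i : shift_at k i 0 = k.
Proof. by apply/funext => j; rewrite /shift_at mul0r addr0. Qed.

Lemma lip_slice L Psi k i : coord_lip L Psi -> lipschitzR L (fun u => Psi (shift_at k i u)).
Proof.
move=> PL s t; rewrite (_ : shift_at k i s = shift_at (shift_at k i t) i (s - t)); first exact: PL.
by rewrite shift_atD subrKC.
Qed.

Lemma lip_cst a : lip (fun _ : I -> R => a).
Proof. by exists 0 => k i u; rewrite subrr normr0 mul0r. Qed.

Lemma lipD Psi Phi : lip Psi -> lip Phi -> lip (fun k => Psi k + Phi k).
Proof.
move=> [L PL] [M FM]; exists (L + M) => k i u.
by rewrite opprD addrACA (le_trans (ler_normD _ _))// mulrDl lerD.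
Qed.

Lemma lipZ a Psi : lip Psi -> lip (fun k => a * Psi k).
Proof.
move=> [L PL]; exists (`|a| * L) => k i u.
by rewrite -mulrBr normrM -mulrA ler_wpM2l.
Qed.

Lemma lipB Psi Phi : lip Psi -> lip Phi -> lip (fun k => Psi k - Phi k).
Proof.
move=> lP lF; have := lipD lP (lipZ (-1) lF).
by under eq_fun do rewrite mulN1r.
Qed.

Lemma lip_sum (J : Type) (r : seq J) (P : pred J) (F : J -> (I -> R) -> R) :
  (forall j : J, lip (F j)) -> lip (fun k => \sum_(j <- r | P (j : J)) F j k).
Proof.
move=> lF; elim: r => [|j r IHr].
  by under eq_fun do rewrite big_nil; exact: lip_cst.
rewrite (_ : (fun k => _) = if P j then fun k => F j k + \sum_(l <- r | P l) F l k
    else fun k => \sum_(l <- r | P l) F l k).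
  by case: ifP => // _; exact: lipD.
by apply/funext => k; rewrite big_cons; case: ifP.
Qed.

Lemma lipM C Psi Phi : (forall k, `|Psi k| <= C) -> (forall k, `|Phi k| <= C) ->
  lip Psi -> lip Phi -> lip (fun k => Psi k * Phi k).
Proof.
move=> PC FC [L PL] [M FM].
have C0 : 0 <= C := le_trans (normr_ge0 _) (PC (fun=> 0)).
exists (C * L + C * M) => k i u.
rewrite (_ : _ - _ = Phi (shift_at k i u) * (Psi (shift_at k i u) - Psi k) +
   Psi k * (Phi (shift_at k i u) - Phi k)); last by ring.
by rewrite (le_trans (ler_normD _ _))// mulrDl !normrM -!mulrA lerD// ler_pM.
Qed.

Lemma step_growth sg i x Psi k : lip Psi ->
  exp_growth (fun t => Psi (shift_at k i (sg * (Num.sqrt x * t + x)))).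
Proof.
move=> [L PL].
rewrite (_ : (fun t => _) = (fun t => Psi (shift_at k i (sg * Num.sqrt x * t + sg * x)))).
  exact: (exp_growth_comp_affine (sg * Num.sqrt x) (sg * x)
    (exp_growth_lipschitz (lip_slice k i PL))).
by apply/funext => t; rewrite mulrDr mulrA.
Qed.

Lemma step_lip sg i x Psi : lip Psi -> lip (step sg i x Psi).
Proof.
move=> lP; have [L PL] := lP; exists L => k j u.
rewrite /step -(gmean_cst (L * `|u|)); apply: ler_dist_gmean.
- exact: step_growth.
- exact: step_growth.
- exact: exp_growth_cst.
- by move=> t; rewrite shift_atC; exact: PL.
Qed.

Lemma step0 sg i Psi : step sg i 0 Psi = Psi.
Proof.
apply/funext => k; rewrite /step sqrtr0.
under eq_fun do rewrite mul0r addr0 mulr0 shift_at0.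
exact: gmean_cst.
Qed.

Lemma stepC sg sg' i j x y Psi : lip Psi ->
  step sg i x (step sg' j y Psi) = step sg' j y (step sg i x Psi).
Proof.
move=> lP; have [L PL] := lP; apply/funext => k; rewrite /step.
under [in RHS]eq_fun => t do under eq_fun do rewrite shift_atC.
pose La := L * `|sg * Num.sqrt x|; pose Lb := L * `|sg' * Num.sqrt y|.
have L0 : 0 <= L by have := lipschitzR_ge0 (lip_slice k i PL).
apply: (@gmean_swap _ (La + Lb)) => [s s' t|s t t'].
- rewrite shift_atC [in X in _ - X]shift_atC (le_trans (lip_slice _ i PL _ _))//.
  rewrite (_ : _ - _ = sg * Num.sqrt x * (s - s')); last by ring.
  by rewrite normrM mulrA ler_wpM2r// lerDl mulr_ge0.
- rewrite (le_trans (lip_slice _ j PL _ _))//.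
  rewrite (_ : _ - _ = sg' * Num.sqrt y * (t - t')); last by ring.
  by rewrite normrM mulrA ler_wpM2r// lerDr mulr_ge0.
Qed.

(** Semigroup property: independent Gaussians add both their means and their variances. It holds in
    this form because the mean of the increment equals its variance. *)
Lemma step_add i x y Psi : 0 <= x -> 0 <= y -> lip Psi ->
  step 1 i x (step 1 i y Psi) = step 1 i (x + y) Psi.
Proof.
move=> x0 y0 lP; have [L PL] := lP.
(* The rotation needs positive coefficients, so zero strengths are treated apart. *)
have [->|xN0] := eqVneq x 0; first by rewrite step0 add0r.
have [->|yN0] := eqVneq y 0; first by rewrite step0 addr0.
have {x0}x0 : 0 < x by rewrite lt_def xN0.
have {y0}y0 : 0 < y by rewrite lt_def yN0.
apply/funext => k; rewrite /step.
pose F v := Psi (shift_at k i (1 * v + (x + y))).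
have FL := lipschitzR_affine 1 (x + y) (lip_slice k i PL).
have := @gmean_rotation R _ F (Num.sqrt y) (Num.sqrt x) (Num.sqrt (x + y)).
rewrite !sqrtr_gt0 !sqr_sqrtr ?addr_ge0 ?ltW// => H.
have {H} := H _ y0 x0 (addr_gt0 x0 y0) (addrC _ _) FL; rewrite /F => H.
transitivity (gmean (fun t => gmean (fun s => F (Num.sqrt y * s + Num.sqrt x * t)))).
  congr gmean; apply/funext => t; congr gmean; apply/funext => s.
  by rewrite shift_atD /F; congr (Psi (shift_at k i _)); ring.
by rewrite H; congr gmean; apply/funext => t; congr (Psi (shift_at k i _)); ring.
Qed.

(** Here [s] dominates [Num.sqrt d] and, being at most 1, also [d <= s ^+ 2 <= s]. *)
Lemma normal_increment_bound (d s t : R) : 0 <= s <= 1 -> 0 <= d <= s ^+ 2 ->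
  `|Num.sqrt d * t + d| <= s * (`|t| + 1).
Proof.
move=> /andP[s0 s1] /andP[d0 ds].
have ss : Num.sqrt d <= s by rewrite -(ger0_norm s0) -sqrtr_sqr ler_wsqrtr.
rewrite (le_trans (ler_normD _ _))// mulrDr mulr1 lerD//.
  by rewrite normrM ger0_norm// ler_wpM2r.
rewrite ger0_norm// (le_trans ds)// expr2 ler_piMr//.
Qed.

Lemma exp_growth_abs1 : exp_growth (fun t : R => `|t| + 1).
Proof.
by apply: exp_growthD; [exact/exp_growth_norm/exp_growth_id|exact: exp_growth_cst].
Qed.

Lemma step_dist L Psi i k (d s : R) : 0 <= s <= 1 -> 0 <= d <= s ^+ 2 ->
  coord_lip L Psi ->
  `|step 1 i d Psi k - Psi k| <= s * (L * gmean (fun t : R => `|t| + 1)).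
Proof.
move=> s01 ds PL.
have L0 : 0 <= L by have := lipschitzR_ge0 (lip_slice k i PL).
rewrite -[X in _ - X]gmean_cst -!gmeanZ; first last.
- exact: exp_growth_abs1.
- exact: exp_growthM (exp_growth_cst _) exp_growth_abs1.
apply: ler_dist_gmean.
- by apply: step_growth; exists L.
- exact: exp_growth_cst.
- apply: exp_growthM; first exact: exp_growth_cst.
  exact: exp_growthM (exp_growth_cst _) exp_growth_abs1.
move=> t; rewrite mul1r (le_trans (PL _ _ _))// mulrCA ler_wpM2l//.
exact: normal_increment_bound.
Qed.

(** The increment has mean [d] and second moment [d + d ^+ 2], so the linear and the quadratic
    coefficient both contribute to order [d]. The leftover [b * d ^+ 2] is at most [|b| * s ^+ 4],
    hence at most [|b| * s ^+ 3]. *)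
Lemma step_taylor Psi i k (a b C d s : R) : 0 <= s <= 1 -> 0 <= d <= s ^+ 2 ->
  0 <= C -> lip Psi ->
  (forall u, `|Psi (shift_at k i u) - Psi k - u * a - u ^+ 2 * b| <= C * `|u| ^+ 3) ->
  `|step 1 i d Psi k - Psi k - d * (a + b)| <=
    s ^+ 3 * (C * gmean (fun t : R => (`|t| + 1) ^+ 3) + `|b|).
Proof.
move=> s01 ds C0 lP PT.
have /andP[s0 s1] := s01; have /andP[d0 ds2] := ds.
pose U t := Num.sqrt d * t + d.
have gU : exp_growth U.
  apply: exp_growthD; last exact: exp_growth_cst.
  by apply: exp_growthM; [exact: exp_growth_cst|exact: exp_growth_id].
have gU1 : exp_growth (fun t => a * U t) by apply: exp_growthM => //; exact: exp_growth_cst.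
have gU2 : exp_growth (fun t => b * U t ^+ 2).
  by apply: exp_growthM; [exact: exp_growth_cst|exact: exp_growthX].
have gc := @exp_growth_cst R (Psi k).
have mE : gmean (fun t => Psi k + a * U t + b * U t ^+ 2) =
    Psi k + a * d + b * (d + d ^+ 2).
  rewrite (gmeanD (exp_growthD gc gU1) gU2) (gmeanD gc gU1) gmean_cst.
  rewrite !gmeanZ//; last exact: exp_growthX.
  by rewrite gmean_affine gmean_affine_sqr sqr_sqrtr.
have main : `|step 1 i d Psi k - gmean (fun t => Psi k + a * U t + b * U t ^+ 2)| <=
    s ^+ 3 * (C * gmean (fun t : R => (`|t| + 1) ^+ 3)).
  rewrite -!gmeanZ; first last.
  - exact: exp_growth_cube.
  - exact: exp_growthM (exp_growth_cst _) exp_growth_cube.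
  apply: ler_dist_gmean.
  - exact: step_growth.
  - exact: exp_growthD (exp_growthD gc gU1) gU2.
  - apply: exp_growthM; first exact: exp_growth_cst.
    exact: exp_growthM (exp_growth_cst _) exp_growth_cube.
  move=> t; rewrite mul1r -/(U t).
  rewrite (_ : _ - _ = Psi (shift_at k i (U t)) - Psi k - U t * a - U t ^+ 2 * b); last by ring.
  rewrite (le_trans (PT _))// [leRHS]mulrCA; apply: ler_wpM2l => //.
  rewrite -exprMn; apply: lerXn2r; rewrite ?nnegrE ?mulr_ge0//.
  exact: normal_increment_bound.
rewrite mE in main.
rewrite (_ : _ - _ = step 1 i d Psi k - (Psi k + a * d + b * (d + d ^+ 2)) + b * d ^+ 2); last by ring.
rewrite (le_trans (ler_normD _ _))// [leRHS]mulrDr lerD// normrM mulrC ler_wpM2r//.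
rewrite ger0_norm ?sqr_ge0// (@le_trans _ _ ((s ^+ 2) ^+ 2))//.
  by rewrite ler_pXn2r ?nnegrE// sqr_ge0.
by rewrite -exprM (exprSr _ 3) ler_piMr// exprn_ge0.
Qed.

Lemma steps_lip sg w s Psi : lip Psi -> lip (steps sg w s Psi).
Proof. by move=> lP; elim: s => [//|i s IHs] /=; exact: step_lip. Qed.

Lemma steps_dist C sg w s Psi Phi : lip Psi -> lip Phi ->
  (forall k, `|Psi k - Phi k| <= C) ->
  forall k, `|steps sg w s Psi k - steps sg w s Phi k| <= C.
Proof.
move=> lP lF PF; elim: s => [//|i s IHs] k /=.
rewrite /step -(gmean_cst C); apply: ler_dist_gmean.
- exact/step_growth/steps_lip.
- exact/step_growth/steps_lip.
- exact: exp_growth_cst.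
- by move=> t; exact: IHs.
Qed.

Lemma steps_cst sg w s a : steps sg w s (fun=> a) = fun=> a.
Proof.
by elim: s => [//|i s IHs] /=; rewrite IHs; apply/funext => k; exact: gmean_cst.
Qed.

Lemma steps_ge0 sg w s Psi : lip Psi -> (forall k, 0 <= Psi k) ->
  forall k, 0 <= steps sg w s Psi k.
Proof.
move=> lP P0; elim: s => [//|i s IHs] k /=.
by apply: Rintegral_ge0 => t _; exact: IHs.
Qed.

Lemma stepsD sg w s Psi Phi : lip Psi -> lip Phi ->
  steps sg w s (fun k => Psi k + Phi k) =
  fun k => steps sg w s Psi k + steps sg w s Phi k.
Proof.
move=> lP lF; elim: s => [//|i s IHs] /=; rewrite IHs; apply/funext => k.
by rewrite /step gmeanD//; exact/step_growth/steps_lip.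
Qed.

Lemma stepsZ a sg w s Psi : lip Psi ->
  steps sg w s (fun k => a * Psi k) = fun k => a * steps sg w s Psi k.
Proof.
move=> lP; elim: s => [//|i s IHs] /=; rewrite IHs; apply/funext => k.
by rewrite /step gmeanZ//; exact/step_growth/steps_lip.
Qed.

Lemma stepsB sg w s Psi Phi : lip Psi -> lip Phi ->
  steps sg w s (fun k => Psi k - Phi k) =
  fun k => steps sg w s Psi k - steps sg w s Phi k.
Proof.
move=> lP lF; have := @stepsD sg w s _ _ lP (lipZ (-1) lF); rewrite stepsZ//.
under eq_fun do rewrite mulN1r; move=> ->.
by apply/funext => k; rewrite mulN1r.
Qed.

Lemma steps_sum (J : Type) (r : seq J) (P : pred J) (F : J -> (I -> R) -> R) sg w s :
  (forall j : J, lip (F j)) ->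
  steps sg w s (fun k => \sum_(j <- r | P (j : J)) F j k) =
  fun k => \sum_(j <- r | P j) steps sg w s (F j) k.
Proof.
move=> lF; elim: r => [|j r IHr].
  under eq_fun do rewrite big_nil; rewrite steps_cst.
  by apply/funext => k; rewrite big_nil.
have consE (G : J -> (I -> R) -> R) : (fun k => \sum_(l <- j :: r | P l) G l k) =
    if P j then fun k => G j k + \sum_(l <- r | P l) G l k
    else fun k => \sum_(l <- r | P l) G l k.
  by apply/funext => k; rewrite big_cons; case: ifP.
rewrite !consE; case: ifP => // _.
by rewrite stepsD ?IHr//; exact: lip_sum.
Qed.

Lemma steps_step s w i x Psi : lip Psi ->
  steps (fun=> 1) w s (step 1 i x Psi) = step 1 i x (steps (fun=> 1) w s Psi).
Proof.
move=> lP; elim: s => [//|j s IHs] /=.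
by rewrite IHs stepC//; exact: steps_lip.
Qed.

Lemma eq_steps sg s w w' Psi : {in s, w =1 w'} -> steps sg w s Psi = steps sg w' s Psi.
Proof.
elim: s => [//|i s IHs] /= ww; rewrite ww ?mem_head// IHs// => j js.
by rewrite ww// in_cons js orbT.
Qed.

(** By the semigroup property the draw at [i] splits into the old draw and an independent increment,
    which commutes with the later draws and can be moved innermost. A change of strength thus
    becomes a change of the averaged function. *)
Lemma steps_shift_at s w i x Psi : uniq s -> i \in s -> 0 <= w i -> 0 <= x -> lip Psi ->
  steps (fun=> 1) (shift_at w i x) s Psi = steps (fun=> 1) w s (step 1 i x Psi).
Proof.
move=> us si w0 x0 lP; elim: s us si => [//|j s IHs] /= /andP[js us].
rewrite in_cons => /predU1P[ij|si].
  subst j; transitivity (step 1 i (w i + x) (steps (fun=> 1) (shift_at w i x) s Psi)).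
    by rewrite {1}/shift_at eqxx mulr1.
  rewrite -(@step_add i (w i) x)//; last exact: steps_lip.
  rewrite steps_step// (@eq_steps _ s _ w)// => l ls.
  rewrite /shift_at (negbTE (_ : l != i)) ?mulr0 ?addr0//.
  by apply: contraNneq js => <-.
rewrite IHs// /shift_at (negbTE (_ : j != i)) ?mulr0 ?addr0//.
by apply: contraNneq js => ->.
Qed.

End Steps.

(** * The Ising model as a function of its couplings: derivatives, uniform bounds and expansions *)

Definition energy {R : realType} {V : finType} (k : {set V} -> R)
  (S : {ffun V -> bool}) : R := \sum_A k A * spinprod S A.

Definition weighted {R : realType} {V : finType} (f : {ffun V -> bool} -> R)
  (k : {set V} -> R) : R := \sum_S f S * expR (energy k S).

Definition gibbs_avg {R : realType} {V : finType} (f : {ffun V -> bool} -> R)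
  (k : {set V} -> R) : R := weighted f k / weighted (fun=> 1) k.

Definition log_partition {R : realType} {V : finType} (k : {set V} -> R) : R :=
  ln (weighted (fun=> 1) k).

Definition magnet {R : realType} {V : finType} (A : {set V}) : ({set V} -> R) -> R :=
  gibbs_avg (fun S => spinprod S A).

Definition corr {R : realType} {V : finType} (A B : {set V}) (k : {set V} -> R) : R :=
  gibbs_avg (fun S => spinprod S A * spinprod S B) k - magnet A k * magnet B k.

(** Gauge transformation: it is undone by multiplying the configuration sitewise by [tau], so it
    preserves the partition function. *)
Definition gauge {R : realType} {V : finType} (tau : {ffun V -> bool})
  (k : {set V} -> R) : {set V} -> R := fun A => spinprod tau A * k A.

Section Ising.
Set Implicit Arguments.
Unset Strict Implicit.
Import numFieldNormedType.Exports.
Context {R : realType} {V : finType}.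
Implicit Types (k w : {set V} -> R) (A B : {set V}) (S T : {ffun V -> bool})
  (f g : {ffun V -> bool} -> R).

Lemma spinprod_sqr S A : spinprod S A * spinprod S A = 1 :> R.
Proof.
rewrite /spinprod -big_split big1//= => i _.
by rewrite /spin; case: (S i); rewrite ?mulr1// mulrNN mulr1.
Qed.

Lemma normr_spinprod S A : `|spinprod S A : R| = 1.
Proof.
have /eqP := spinprod_sqr S A; rewrite -expr2 sqrf_eq1 => /orP[] /eqP ->.
  exact: normr1.
by rewrite normrN1.
Qed.

Lemma energy_shift_at k A u S : energy (shift_at k A u) S = energy k S + u * spinprod S A.
Proof.
rewrite /energy /shift_at (eq_bigr (fun B => k B * spinprod S B +
  (if B == A then u * spinprod S B else 0))); last first.
  by move=> B _; rewrite mulrDl; case: eqP; rewrite ?mulr1// mulr0 mul0r.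
by rewrite big_split/= -big_mkcond big_pred1_eq.
Qed.

Lemma weighted1_gt0 k : 0 < weighted (fun=> 1) k.
Proof.
rewrite /weighted (bigD1 [ffun=> true])//= mul1r ltr_pwDl ?expR_gt0//.
by apply: sumr_ge0 => S _; rewrite mul1r expR_ge0.
Qed.

Lemma weighted1_neq0 k : weighted (fun=> 1) k != 0.
Proof. by rewrite gt_eqF// weighted1_gt0. Qed.

Lemma gibbs_avg_le C f k : (forall S, `|f S| <= C) -> `|gibbs_avg f k| <= C.
Proof.
move=> fC; rewrite /gibbs_avg normrM normfV (gtr0_norm (weighted1_gt0 k)).
rewrite ler_pdivrMr ?weighted1_gt0// /weighted mulr_sumr.
rewrite (le_trans (ler_norm_sum _ _ _))// ler_sum// => S _.
by rewrite normrM mul1r (ger0_norm (expR_ge0 _)) ler_wpM2r// expR_ge0.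
Qed.

Lemma magnet_le1 A k : `|magnet A k| <= 1.
Proof. by apply: gibbs_avg_le => S; rewrite normr_spinprod. Qed.

Lemma corr_le2 A B k : `|corr A B k| <= 2.
Proof.
rewrite (le_trans (ler_normB _ _))// -[leRHS]/(1 + 1) lerD//.
  by apply: gibbs_avg_le => S; rewrite normrM !normr_spinprod mulr1.
by rewrite normrM mulr_ile1// magnet_le1.
Qed.

Lemma is_derive_bigsum (J : Type) (r : seq J) (F : J -> R -> R) (dF : J -> R) (x : R) :
  (forall j, is_derive x 1 (F j) (dF j)) ->
  is_derive x 1 (fun u : R => \sum_(j <- r) F j u) (\sum_(j <- r) dF j).
Proof.
move=> FdF; elim: r => [|j r IHr].
  by rewrite big_nil; under eq_fun do rewrite big_nil; exact: is_derive_cst.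
rewrite big_cons; under eq_fun do rewrite big_cons.
exact: is_deriveD.
Qed.

Lemma is_derive_weighted f k A (x : R) :
  is_derive x 1 (fun u : R => weighted f (shift_at k A u))
    (weighted (fun S => f S * spinprod S A) (shift_at k A x)).
Proof.
rewrite /weighted; apply: is_derive_bigsum => S.
rewrite (_ : (fun u : R => _) = (fun u => f S * expR (energy k S + u * spinprod S A))).
  by apply: is_derive_eq; rewrite energy_shift_at /GRing.scale/=; ring.
by apply/funext => u; rewrite energy_shift_at.
Qed.

Lemma is_derive_gibbs_avg f k A (x : R) :
  is_derive x 1 (fun u : R => gibbs_avg f (shift_at k A u))
    (gibbs_avg (fun S => f S * spinprod S A) (shift_at k A x) -
     gibbs_avg f (shift_at k A x) * magnet A (shift_at k A x)).
Proof.
have dN := is_derive_weighted f k A x.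
have dZ := is_derive_weighted (fun=> 1) k A x.
have Z0 := weighted1_neq0 (shift_at k A x).
have dV := is_deriveV Z0 dZ.
rewrite /gibbs_avg.
apply: is_derive_eq; rewrite /GRing.scale/= /magnet /gibbs_avg.
have -> : weighted (fun S => 1 * spinprod S A) (shift_at k A x) =
    weighted (fun S => spinprod S A) (shift_at k A x).
  by apply: eq_bigr => S _; rewrite mul1r.
by field.
Qed.

Lemma is_derive_log_partition k A (x : R) :
  is_derive x 1 (fun u : R => log_partition (shift_at k A u)) (magnet A (shift_at k A x)).
Proof.
have dZ := is_derive_weighted (fun=> 1) k A x.
have dL := is_derive1_ln (weighted1_gt0 (shift_at k A x)).
have dC := @is_derive1_comp R (@ln R) (fun u : R => weighted (fun=> 1) (shift_at k A u)) x _ _ dL dZ.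
apply: is_derive_eq; rewrite /GRing.scale/= /magnet /gibbs_avg mulrC; congr (_ / _).
by apply: eq_bigr => S _; rewrite mul1r.
Qed.

Lemma coord_lip_derive L (F : ({set V} -> R) -> R) (dF : {set V} -> ({set V} -> R) -> R) :
  (forall k A (x : R), is_derive x 1 (fun u : R => F (shift_at k A u)) (dF A (shift_at k A x))) ->
  (forall A k, `|dF A k| <= L) -> coord_lip L F.
Proof.
move=> FdF dFL k A u.
have [v _] := MVT_at0 u (FdF k A); rewrite shift_at0 => ->.
by rewrite normrM ler_wpM2r.
Qed.

(** The derivative in a coupling is a covariance of functions bounded by 1, hence at most 2 whatever
    the other couplings are. *)
Lemma lip_gibbs_avg f : (forall S, `|f S| <= 1) -> lip (gibbs_avg f).
Proof.
move=> f1; exists 2; apply: (@coord_lip_derive 2 (gibbs_avg f)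
  (fun A k => gibbs_avg (fun S => f S * spinprod S A) k - gibbs_avg f k * magnet A k)).
  by move=> k A x; exact: is_derive_gibbs_avg.
move=> A k.
rewrite (le_trans (ler_normB _ _))// -[leRHS]/(1 + 1) lerD//.
  by apply: gibbs_avg_le => S; rewrite normrM normr_spinprod mulr1.
by rewrite normrM mulr_ile1// ?magnet_le1// gibbs_avg_le.
Qed.

Lemma lip_magnet A : lip (@magnet R V A).
Proof. by apply: lip_gibbs_avg => S; rewrite normr_spinprod. Qed.

Lemma lip_magnet_sqr A : lip (fun k => magnet A k ^+ 2 : R).
Proof.
under eq_fun do rewrite expr2.
by apply: (@lipM _ _ 1); [exact: magnet_le1|exact: magnet_le1|exact: lip_magnet..].
Qed.

Lemma lip_corr A B : lip (@corr R V A B).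
Proof.
apply: lipB.
  by apply: lip_gibbs_avg => S; rewrite normrM !normr_spinprod mulr1.
by apply: (@lipM _ _ 1); [exact: magnet_le1|exact: magnet_le1|exact: lip_magnet..].
Qed.

Lemma lip_corr_sqr A B : lip (fun k => corr A B k ^+ 2 : R).
Proof.
under eq_fun do rewrite expr2.
by apply: (@lipM _ _ 2); [exact: corr_le2|exact: corr_le2|exact: lip_corr..].
Qed.

Lemma lip_magnet_corr A B : lip (fun k => magnet B k * corr A B k : R).
Proof.
apply: (@lipM _ _ 2); [|exact: corr_le2|exact: lip_magnet|exact: lip_corr].
by move=> k; rewrite (le_trans (magnet_le1 _ _))// ler1n.
Qed.

Lemma lip_log_partition : lip (@log_partition R V).
Proof.
exists 1; apply: (coord_lip_derive is_derive_log_partition) => A k.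
exact: magnet_le1.
Qed.

Lemma is_derive_magnet k A (x : R) :
  is_derive x 1 (fun u : R => magnet A (shift_at k A u)) (1 - magnet A (shift_at k A x) ^+ 2).
Proof.
have := is_derive_gibbs_avg (fun S => spinprod S A) k A x.
rewrite expr2 (_ : gibbs_avg (fun S => spinprod S A * spinprod S A) _ = 1)//.
rewrite /gibbs_avg (_ : weighted (fun S => spinprod S A * spinprod S A) _ =
  weighted (fun=> 1) (shift_at k A x)) ?divff ?weighted1_neq0//.
by apply: eq_bigr => S _; rewrite spinprod_sqr.
Qed.

(** This is the third joint cumulant of [S_A], [S_B], [S_B], which collapses because
    [S_B ^ 2 = 1]. *)
Lemma is_derive_corr k A B (x : R) :
  is_derive x 1 (fun u : R => corr A B (shift_at k B u))
    (- 2 * (magnet B (shift_at k B x) * corr A B (shift_at k B x))).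
Proof.
have d1 := is_derive_gibbs_avg (fun S => spinprod S A * spinprod S B) k B x.
have d2 : is_derive x 1 (fun u : R => magnet A (shift_at k B u)) (corr A B (shift_at k B x)).
  exact: is_derive_gibbs_avg.
have d3 := is_derive_magnet k B x.
apply: is_derive_eq; rewrite /GRing.scale/= /corr.
have -> : gibbs_avg (fun S => spinprod S A * spinprod S B * spinprod S B) (shift_at k B x) =
    magnet A (shift_at k B x).
  congr (_ / _); apply: eq_bigr => S _.
  by rewrite -mulrA spinprod_sqr mulr1.
by ring.
Qed.

(** [C] is a Lipschitz constant of the second derivative [1 - magnet A k ^+ 2], which makes it
    independent of [k]. *)
Lemma log_partition_taylor A : exists2 C : R, 0 <= C & forall k (u : R),
  `|log_partition (shift_at k A u) - log_partition k - u * magnet A k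
    - u ^+ 2 * ((1 - magnet A k ^+ 2) / 2)| <= C * `|u| ^+ 3.
Proof.
have [L mL] := lipB (lip_cst 1) (lip_magnet_sqr A).
have L0 : 0 <= L by have := lipschitzR_ge0 (lip_slice (fun=> 0) A mL).
exists L => // k u.
have := @taylor2_bound _ _ _ _ L u L0 (is_derive_log_partition k A) (is_derive_magnet k A).
by rewrite /= !shift_at0; apply => v _; exact: mL.
Qed.

Lemma magnet_taylor A B : exists2 C : R, 0 <= C & forall k (u : R),
  `|magnet A (shift_at k B u) - magnet A k - u * corr A B k
    - u ^+ 2 * (- (magnet B k * corr A B k))| <= C * `|u| ^+ 3.
Proof.
have [L cL] := lipZ (- 2) (lip_magnet_corr A B).
have L0 : 0 <= L by have := lipschitzR_ge0 (lip_slice (fun=> 0) A cL).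
exists L => // k u.
have d2 (x : R) : is_derive x 1 (fun u : R => magnet A (shift_at k B u)) (corr A B (shift_at k B x)).
  exact: is_derive_gibbs_avg.
have := @taylor2_bound _ _ _ _ L u L0 d2 (is_derive_corr k A B).
rewrite /= !shift_at0 [_ / 2](_ : _ = - (magnet B k * corr A B k)); last by field.
by apply => v _; exact: cL.
Qed.

(* [corr A B] squared is a two-replica average of a product of a function of [A]
   and the same function of [B]. *)
Lemma corr_sqr_psd (h : {set V} -> R) k :
  0 <= \sum_A \sum_B h A * h B * corr A B k ^+ 2.
Proof.
pose Z := weighted (fun=> 1) k.
pose p S := expR (energy k S) / Z.
have p0 S : 0 <= p S by rewrite divr_ge0 ?expR_ge0// ltW// weighted1_gt0.
have avgE f : gibbs_avg f k = \sum_S p S * f S.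
  rewrite /gibbs_avg /weighted mulr_suml; apply: eq_bigr => S _.
  by rewrite -mulrA mulrC.
have p1 : \sum_S p S = 1.
  have := avgE (fun=> 1); rewrite /gibbs_avg divff ?weighted1_neq0// => ->.
  by apply: eq_bigr => S _; rewrite mulr1.
have mulp1 x : \sum_S p S * x = x by rewrite -[RHS]mul1r -p1 mulr_suml.
pose a A S := spinprod S A - magnet A k.
have corrE A B : corr A B k = \sum_S p S * (a A S * a B S).
  rewrite /a (eq_bigr (fun S => p S * (spinprod S A * spinprod S B) -
    (p S * spinprod S A) * magnet B k - (p S * spinprod S B) * magnet A k +
    p S * (magnet A k * magnet B k))); last by move=> S _; ring.
  rewrite !(sumrB, big_split)/= mulp1 -!mulr_suml -!avgE /corr -/(magnet A k) -/(magnet B k).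
  by ring.
suff -> : \sum_A \sum_B h A * h B * corr A B k ^+ 2 =
    \sum_S \sum_T p S * p T * (\sum_A h A * (a A S * a A T)) ^+ 2.
  apply: sumr_ge0 => S _; apply: sumr_ge0 => T _.
  by rewrite mulr_ge0 ?sqr_ge0// mulr_ge0.
under [RHS]eq_bigr => S _ do under eq_bigr => T _ do
  (rewrite expr2 mulr_suml mulr_sumr; under eq_bigr => A _ do rewrite !mulr_sumr).
under [RHS]eq_bigr => S _ do (rewrite exchange_big/=; under eq_bigr => A _ do rewrite exchange_big/=).
rewrite [RHS]exchange_big/=; apply: eq_bigr => A _.
rewrite [RHS]exchange_big/=; apply: eq_bigr => B _.
rewrite corrE expr2 mulr_suml mulr_sumr; apply: eq_bigr => S _.
rewrite !mulr_sumr; apply: eq_bigr => T _.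
by ring.
Qed.

End Ising.

(** * Tangent inequality on the orthant from one-sided expansions *)

Section TangentInequality.
Set Implicit Arguments.
Unset Strict Implicit.
Context {R : realType} {I : finType}.
Implicit Types (w d h : I -> R) (i j : I).

Definition nneg w := forall i, 0 <= w i.

(* The errors are expressed in [s], the square root of the increment. *)
Definition continuous_expansion C (G : (I -> R) -> R) := forall w i (d s : R),
  nneg w -> 0 <= s <= 1 -> 0 <= d <= s ^+ 2 -> `|G (shift_at w i d) - G w| <= C * s.

Definition linear_expansion C (F : (I -> R) -> R) (G : I -> (I -> R) -> R) :=
  forall w i (d s : R), nneg w -> 0 <= s <= 1 -> 0 <= d <= s ^+ 2 ->
  `|F (shift_at w i d) - F w - d * G i w| <= C * s ^+ 3.

Lemma shift_at_nneg w i (x : R) : nneg w -> 0 <= x -> nneg (shift_at w i x).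
Proof. by move=> w0 x0 j; rewrite addr_ge0// mulr_ge0. Qed.

Definition shift_all w d (r : seq I) : I -> R := foldr (fun i v => shift_at v i (d i)) w r.

Lemma shift_allE w d r : uniq r ->
  shift_all w d r = fun i => w i + d i * (i \in r)%:R.
Proof.
elim: r => [_|i r IHr /= /andP[ir ur]]; apply/funext => j.
  by rewrite mulr0 addr0.
rewrite IHr// /shift_at in_cons -addrA; congr (_ + _).
have [->|ji] := eqVneq j i; first by rewrite (negbTE ir) mulr0 add0r.
by rewrite mulr0 addr0.
Qed.

Lemma shift_all_nneg w d r : nneg w -> nneg d -> nneg (shift_all w d r).
Proof. by move=> w0 d0; elim: r => [//|i r IHr] /=; exact: shift_at_nneg. Qed.

Lemma shift_all_continuous C G w d (s : R) r : continuous_expansion C G ->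
  nneg w -> 0 <= s <= 1 -> (forall i, 0 <= d i <= s ^+ 2) ->
  `|G (shift_all w d r) - G w| <= (size r)%:R * (C * s).
Proof.
move=> GC w0 s01 ds; elim: r => [|i r IHr] /=; first by rewrite subrr normr0 mul0r.
have d0 : nneg d by move=> j; case/andP: (ds j).
set v := shift_all w d r in IHr *.
rewrite (_ : _ - _ = (G (shift_at v i (d i)) - G v) + (G v - G w)); last by ring.
rewrite (le_trans (ler_normD _ _))// -[in leRHS]add1n natrD mulrDl mul1r lerD//.
by apply: GC => //; exact: shift_all_nneg.
Qed.

(** When coordinates move one at a time, each slope is met at a displaced point. Bringing it back to
    [w] costs [d i] times an error of order [s], hence order [s ^+ 3]; the number of displaced
    coordinates grows at each move, whence the square of the size. *)
Lemma shift_all_linear C F G w d (s : R) r : 0 <= C -> linear_expansion C F G ->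
  (forall i, continuous_expansion C (G i)) ->
  nneg w -> 0 <= s <= 1 -> (forall i, 0 <= d i <= s ^+ 2) ->
  `|F (shift_all w d r) - F w - \sum_(i <- r) d i * G i w| <= (size r)%:R ^+ 2 * (C * s ^+ 3).
Proof.
move=> C0 FG GC w0 s01 ds; elim: r => [|i r IHr] /=.
  by rewrite big_nil subrr subr0 normr0 expr0n mul0r.
have d0 : nneg d by move=> j; case/andP: (ds j).
have s0 : 0 <= s by case/andP: s01.
have Gc := shift_all_continuous r (GC i) w0 s01 ds.
rewrite big_cons; set v := shift_all w d r in IHr Gc *; set n : R := (size r)%:R in IHr Gc *.
rewrite (_ : _ - _ = (F (shift_at v i (d i)) - F v - d i * G i v) + d i * (G i v - G i w) +
  (F v - F w - \sum_(j <- r) d j * G j w)); last by ring.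
have n0 : 0 <= n := ler0n _ _.
have -> : (size r).+1%:R = n + 1 :> R by rewrite -addn1 natrD.
have -> : (n + 1) ^+ 2 * (C * s ^+ 3) =
    C * s ^+ 3 + s ^+ 2 * (n * (C * s)) + n ^+ 2 * (C * s ^+ 3) + n * (C * s ^+ 3) by ring.
rewrite -[leLHS]addr0 lerD ?mulr_ge0 ?exprn_ge0//.
rewrite (le_trans (ler_normD _ _))// lerD// (le_trans (ler_normD _ _))// lerD//.
  by apply: FG => //; exact: shift_all_nneg.
rewrite normrM ler_pM// ger0_norm//; by case/andP: (ds i).
Qed.

Lemma add_continuous C G w d (s : R) : continuous_expansion C G ->
  nneg w -> 0 <= s <= 1 -> (forall i, 0 <= d i <= s ^+ 2) ->
  `|G (fun i => w i + d i) - G w| <= #|I|%:R * (C * s).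
Proof.
move=> GC w0 s01 ds; have := shift_all_continuous (enum I) GC w0 s01 ds.
rewrite shift_allE ?enum_uniq// -cardE.
by under eq_fun do rewrite mem_enum mulr1.
Qed.

Lemma add_linear C F G w d (s : R) : 0 <= C -> linear_expansion C F G ->
  (forall i, continuous_expansion C (G i)) ->
  nneg w -> 0 <= s <= 1 -> (forall i, 0 <= d i <= s ^+ 2) ->
  `|F (fun i => w i + d i) - F w - \sum_i d i * G i w| <= #|I|%:R ^+ 2 * (C * s ^+ 3).
Proof.
move=> C0 FG GC w0 s01 ds; have := shift_all_linear (enum I) C0 FG GC w0 s01 ds.
rewrite shift_allE ?enum_uniq// -cardE big_enum/=.
by under eq_fun do rewrite mem_enum mulr1.
Qed.

(** [p] and [q] act as gradient and Hessian of [f], but only for nonnegative increments from points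
    of the orthant. *)
Variables (C : R) (f : (I -> R) -> R) (p : I -> (I -> R) -> R)
  (q : I -> I -> (I -> R) -> R).
Hypotheses (C0 : 0 <= C) (fp : linear_expansion C f p)
  (pq : forall i, linear_expansion C (p i) (q i))
  (pC : forall i, continuous_expansion C (p i))
  (qC : forall i j, continuous_expansion C (q i j))
  (q_psd : forall h w, nneg w -> 0 <= \sum_i \sum_j h i * h j * q i j w).

(** One constant that dominates those of both [add_continuous] and [add_linear]. *)
Let K := #|I|%:R * C + #|I|%:R ^+ 2 * C.

Let cardC0 : 0 <= #|I|%:R * C. Proof. by rewrite mulr_ge0. Qed.
Let card2C0 : 0 <= #|I|%:R ^+ 2 * C. Proof. by rewrite mulr_ge0 ?exprn_ge0. Qed.
Let K0 : 0 <= K. Proof. exact: addr_ge0. Qed.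

(** The increments [e * h i] have both signs while the expansions accept only nonnegative ones, so
    both endpoints are reached from their coordinatewise minimum [b] and the two expansions are
    subtracted. This costs [2 * K]; moving [P] from [b] to [w] costs the further [H * K]. In the
    second bound the quadratic form at [b] is nonnegative and is dropped. *)
Lemma tangent_step w h (e s : R) :
  nneg w -> nneg (fun i => w i + e * h i) -> 0 <= s <= 1 -> 0 <= e <= s ^+ 2 ->
  (forall i, e * `|h i| <= s ^+ 2) ->
  let H := \sum_i `|h i| in
  let P v := \sum_i h i * p i v in
  e * P w - (H + 2) * K * s ^+ 3 <= f (fun i => w i + e * h i) - f w /\
  - (2 * H * K * s ^+ 3) <= P (fun i => w i + e * h i) - P w.
Proof.
move=> w0 w'0 s01 /andP[e0 es] hs H P.
have s0 : 0 <= s by case/andP: s01.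
have H0 : 0 <= H by exact: sumr_ge0.
pose b i := Num.min (w i) (w i + e * h i).
pose dp i := e * Num.max (h i) 0; pose dm i := e * Num.max (- h i) 0.
have b0 : nneg b by move=> i; rewrite /b le_min w0 w'0.
have dps i : 0 <= dp i <= s ^+ 2.
  rewrite /dp mulr_ge0 ?le_max ?lexx ?orbT//= (le_trans _ (hs i))// ler_wpM2l//.
  by rewrite ge_max ler_norm normr_ge0.
have dms i : 0 <= dm i <= s ^+ 2.
  rewrite /dm mulr_ge0 ?le_max ?lexx ?orbT//= (le_trans _ (hs i))// ler_wpM2l//.
  by rewrite ge_max -normrN ler_norm normr_ge0.
have bh i : [/\ b i + dp i = w i + e * h i, b i + dm i = w i & dp i - dm i = e * h i].
  rewrite /b /dp /dm; have [hi|hi] := leP 0 (h i).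
    have eh : 0 <= e * h i by rewrite mulr_ge0.
    rewrite min_l ?lerDl// max_r ?oppr_le0// mulr0.
    by split; ring.
  have eh : e * h i <= 0 by rewrite mulr_ge0_le0// ltW.
  rewrite min_r ?gerDl// max_l ?oppr_ge0 ?ltW// mulr0.
  by split; ring.
have bp : (fun i => b i + dp i) = (fun i => w i + e * h i).
  by apply/funext => i; case: (bh i).
have bm : (fun i => b i + dm i) = w by apply/funext => i; case: (bh i).
have lin F G : linear_expansion C F G -> (forall i, continuous_expansion C (G i)) ->
    `|F (fun i => w i + e * h i) - F w - \sum_i e * h i * G i b| <= 2 * K * s ^+ 3.
  move=> FG GC.
  have := add_linear C0 FG GC b0 s01 dps; rewrite bp.
  have := add_linear C0 FG GC b0 s01 dms; rewrite bm.
  set w' := fun i => w i + e * h i; rewrite mulrA => Hm Hp.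
  rewrite (_ : \sum_i e * h i * G i b = \sum_i dp i * G i b - \sum_i dm i * G i b); last first.
    by rewrite -sumrB; apply: eq_bigr => i _; case: (bh i) => _ _ <-; rewrite mulrBl.
  set Sp := \sum_i dp i * _ in Hp *; set Sm := \sum_i dm i * _ in Hm *.
  rewrite (_ : _ - _ = (F w' - F b - Sp) - (F w - F b - Sm)); last by ring.
  rewrite (le_trans (ler_normB _ _))//.
  have : #|I|%:R ^+ 2 * C * s ^+ 3 <= K * s ^+ 3.
    by rewrite ler_wpM2r ?exprn_ge0// lerDr.
  rewrite mulrA in Hp; lra.
have pb i : `|p i w - p i b| <= K * s.
  have := add_continuous (pC i) b0 s01 dms; rewrite bm mulrA => /le_trans; apply.
  by rewrite ler_wpM2r// lerDl.
have s3 : 0 <= s ^+ 3 by exact: exprn_ge0.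
split.
- have := lin _ _ fp pC; rewrite ler_norml => /andP[Hf _].
  have PE : \sum_i e * h i * p i b = e * P b.
    by rewrite /P mulr_sumr; apply: eq_bigr => i _; rewrite mulrA.
  have Pb : `|P w - P b| <= H * (K * s).
    rewrite /P -sumrB /H mulr_suml (le_trans (ler_norm_sum _ _ _))// ler_sum// => i _.
    by rewrite -mulrBr normrM ler_wpM2l.
  have ePb : e * (P w - P b) <= H * K * s ^+ 3.
    rewrite (@le_trans _ _ (s ^+ 2 * (H * (K * s))))//; last first.
      by rewrite le_eqVlt; apply/orP; left; apply/eqP; ring.
    rewrite (le_trans (ler_norm _))// normrM ger0_norm// ler_pM//.
  rewrite PE in Hf; lra.
- have Hp i : `|p i (fun i => w i + e * h i) - p i w - \sum_j e * h j * q i j b| <=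
      2 * K * s ^+ 3 by apply: lin => //; exact: pq.
  have quad : \sum_i h i * (\sum_j e * h j * q i j b) = e * \sum_i \sum_j h i * h j * q i j b.
    rewrite mulr_sumr; apply: eq_bigr => i _; rewrite !mulr_sumr; apply: eq_bigr => j _.
    by ring.
  have quad0 : 0 <= e * \sum_i \sum_j h i * h j * q i j b by rewrite mulr_ge0// q_psd.
  rewrite -quad in quad0; set w' := (fun i => w i + e * h i) in Hp *.
  have : `|P w' - P w - \sum_i h i * (\sum_j e * h j * q i j b)| <= H * (2 * K * s ^+ 3).
    rewrite /P -!sumrB /H mulr_suml (le_trans (ler_norm_sum _ _ _))// ler_sum// => i _.
    by rewrite -!mulrBr normrM ler_wpM2l.
  rewrite ler_norml => /andP[+ _]; lra.
Qed.

(* Subdividing the segment into [n ^ 2] steps of size [1 / n ^ 2], each of the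
   [n ^ 2] errors is of order [1 / n ^ 3]. *)
Lemma tangent_inequality x0 x1 : nneg x0 -> nneg x1 ->
  f x0 + \sum_i (x1 i - x0 i) * p i x0 <= f x1.
Proof.
move=> x00 x10; pose h i := x1 i - x0 i.
pose H := \sum_i `|h i|; have H0 : 0 <= H by exact: sumr_ge0.
have hH i : `|h i| <= H by rewrite /H (bigD1 i)//= lerDl sumr_ge0.
pose P v := \sum_i h i * p i v.
(* [m] bounds 1 and every [|h i|], so with [s = m / n] both [1 / n ^ 2] and [|h i| / n ^ 2] are at
   most [s ^+ 2]; [m <= n] ensures [s <= 1]. *)
pose m : nat := (Num.truncn H).+1.
have Hm : H <= m%:R by rewrite ltW// Num.Theory.truncnS_gt.
have m1 : 1 <= m%:R :> R by rewrite ler1n.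
have m0 : 0 < m%:R :> R by rewrite ltr0n.
pose L := (2 * H * K + (H + 2) * K) * m%:R ^+ 3.
have L0 : 0 <= L.
  by rewrite mulr_ge0 ?exprn_ge0// addr_ge0// !mulr_ge0// addr_ge0.
suff main (n : nat) : (m <= n)%N -> f x0 + P x0 <= f x1 + L / n%:R.
  apply/ler_addgt0Pr => e e0.
  pose n := maxn m (Num.truncn (L / e)).+1.
  have n0 : 0 < n%:R :> R by rewrite ltr0n (leq_trans _ (leq_maxl _ _)).
  rewrite (le_trans (main n (leq_maxl _ _)))// lerD2l ler_pdivrMr// mulrC -ler_pdivrMr//.
  rewrite (le_trans (ltW (Num.Theory.truncnS_gt _)))// ler_nat leq_maxr//.
move=> mn; have n0 : 0 < n%:R :> R by rewrite ltr0n (leq_trans _ mn).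
pose s : R := m%:R / n%:R; pose e : R := (n%:R ^+ 2)^-1.
have n2 : 0 < n%:R ^+ 2 :> R by rewrite exprn_gt0.
have e0 : 0 < e by rewrite invr_gt0.
have s0 : 0 < s by rewrite divr_gt0.
have s01 : 0 <= s <= 1 by rewrite ltW//= ler_pdivrMr// mul1r ler_nat.
have sE : s ^+ 2 = e * m%:R ^+ 2 by rewrite /s /e expr_div_n mulrC.
have es : 0 <= e <= s ^+ 2.
  by rewrite (ltW e0)/= sE ler_peMr ?(ltW e0)// exprn_ege1.
have ehs i : e * `|h i| <= s ^+ 2.
  rewrite sE ler_wpM2l ?(ltW e0)// (le_trans (hH i))// (le_trans Hm)//.
  by rewrite expr2 ler_peMr// (ltW m0).
pose w (k : nat) i := x0 i + k%:R * e * h i.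
have wS k : w k.+1 = fun i => w k i + e * h i.
  by apply/funext => i; rewrite /w -addn1 natrD; ring.
have w0 k : (k <= n ^ 2)%N -> nneg (w k).
  move=> kn i; have ke : 0 <= k%:R * e <= 1.
    rewrite mulr_ge0 ?(ltW e0)//= /e ler_pdivrMr// mul1r -natrX ler_nat//.
  move: ke => /andP[ke0 ke1]; have := x00 i; have := x10 i.
  by rewrite /w /h; nra.
have step k : (k < n ^ 2)%N ->
    e * P (w k) - (H + 2) * K * s ^+ 3 <= f (w k.+1) - f (w k) /\
    - (2 * H * K * s ^+ 3) <= P (w k.+1) - P (w k).
  move=> kn; rewrite wS; apply: tangent_step => //; first exact: w0 (ltnW kn).
  by rewrite -wS; exact: w0.
have w00 : w 0 = x0 by apply/funext => i; rewrite /w !mul0r addr0.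
have wn : w (n ^ 2)%N = x1.
  by apply/funext => i; rewrite /w natrX /e divff ?gt_eqF// mul1r /h subrKC.
pose E1 := 2 * H * K * s ^+ 3; pose E2 := (H + 2) * K * s ^+ 3.
have s3 : 0 <= s ^+ 3 by rewrite exprn_ge0// ltW.
have E10 : 0 <= E1 by rewrite !mulr_ge0.
have boundP k : (k <= n ^ 2)%N -> P x0 - k%:R * E1 <= P (w k).
  elim: k => [_|k IHk kn]; first by rewrite w00 mul0r subr0.
  have [_] := step _ kn; have := IHk (ltnW kn).
  have -> : k.+1%:R = k%:R + 1 :> R by rewrite -addn1 natrD.
  rewrite -/E1; lra.
(* Every step uses the worst loss of slope over the whole walk, [n ^ 2 * E1], instead of the loss so
   far, which keeps the bound linear in [k]. *)
have boundf k : (k <= n ^ 2)%N ->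
    f x0 + k%:R * (e * (P x0 - n%:R ^+ 2 * E1) - E2) <= f (w k).
  elim: k => [_|k IHk kn]; first by rewrite w00 mul0r addr0.
  have [+ _] := step _ kn; have := IHk (ltnW kn).
  have : e * (P x0 - n%:R ^+ 2 * E1) <= e * P (w k).
    rewrite ler_wpM2l ?(ltW e0)// (le_trans _ (boundP _ (ltnW kn)))// lerD2l lerN2.
    by rewrite ler_wpM2r// -natrX ler_nat ltnW.
  have -> : k.+1%:R = k%:R + 1 :> R by rewrite -addn1 natrD.
  rewrite -/E2 mulrDl mul1r; lra.
have := boundf _ (leqnn _); rewrite wn natrX.
have -> : n%:R ^+ 2 * (e * (P x0 - n%:R ^+ 2 * E1) - E2) =
    (n%:R ^+ 2 * e) * P x0 - (n%:R ^+ 2 * e) * n%:R ^+ 2 * E1 - n%:R ^+ 2 * E2 by ring.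
rewrite [_ * e]divff ?gt_eqF// !mul1r.
have -> : L / n%:R = n%:R ^+ 2 * E1 + n%:R ^+ 2 * E2.
  by rewrite /L /E1 /E2 /s; field; rewrite gt_eqF.
lra.
Qed.

End TangentInequality.

(** * Gauge symmetry, Nishimori identities and the expansions of averaged quantities *)

Section Nishimori.
Set Implicit Arguments.
Unset Strict Implicit.
Context {R : realType} {V : finType}.
Implicit Types (k w : {set V} -> R) (A B : {set V}) (S T tau : {ffun V -> bool})
  (f g : {ffun V -> bool} -> R) (s : seq {set V}).

Lemma gauge_shift_at tau k A (u : R) :
  shift_at (gauge tau k) A (spinprod tau A * u) = gauge tau (shift_at k A u).
Proof.
apply/funext => B; rewrite /gauge /shift_at mulrDr; congr (_ + _).
by case: eqP => [->|]; rewrite ?mulr1// !mulr0.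
Qed.

Lemma gauge0 tau : gauge tau (fun=> 0) = fun=> 0 :> R.
Proof. by apply/funext => A; rewrite /gauge mulr0. Qed.

(** The sitewise product of spins: as [true] encodes 1, equality of booleans encodes the product of
    signs. *)
Definition ffun_xnor tau S : {ffun V -> bool} := [ffun i => S i == tau i].

Lemma ffun_xnorK tau : involutive (ffun_xnor tau).
Proof. by move=> S; apply/ffunP => i; rewrite !ffunE; case: (S i); case: (tau i). Qed.

Lemma spinprod_xnor tau S A :
  spinprod (ffun_xnor tau S) A = spinprod tau A * spinprod S A :> R.
Proof.
rewrite /spinprod -big_split/=; apply: eq_bigr => i _; rewrite /spin ffunE.
by case: (S i); case: (tau i); rewrite /= ?mulr1 ?mul1r// mulrNN mulr1.
Qed.

Lemma weighted_gauge f tau k :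
  weighted f (gauge tau k) = weighted (fun S => f (ffun_xnor tau S)) k.
Proof.
rewrite /weighted (reindex_inj (inv_inj (ffun_xnorK tau)))/=.
apply: eq_bigr => S _; congr (_ * expR _); rewrite /energy; apply: eq_bigr => A _.
by rewrite /gauge spinprod_xnor mulrACA spinprod_sqr mul1r.
Qed.

Lemma gibbs_avg_gauge f (c : R) tau k :
  (forall S, f (ffun_xnor tau S) = c * f S) ->
  gibbs_avg f (gauge tau k) = c * gibbs_avg f k.
Proof.
move=> fc; rewrite /gibbs_avg !weighted_gauge mulrA; congr (_ / _).
by rewrite /weighted mulr_sumr; apply: eq_bigr => S _; rewrite fc mulrA.
Qed.

Lemma magnet_gauge A tau k : magnet A (gauge tau k) = spinprod tau A * magnet A k.
Proof. by apply: gibbs_avg_gauge => S; exact: spinprod_xnor. Qed.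

Lemma corr_gauge A B tau k :
  corr A B (gauge tau k) = spinprod tau A * spinprod tau B * corr A B k.
Proof.
rewrite /corr !magnet_gauge (@gibbs_avg_gauge _ (spinprod tau A * spinprod tau B)).
  by ring.
by move=> S; rewrite !spinprod_xnor; ring.
Qed.

Lemma steps_gauge tau w s (Phi : ({set V} -> R) -> R) k :
  steps (spinprod tau) w s Phi (gauge tau k) =
  steps (fun=> 1) w s (fun k => Phi (gauge tau k)) k.
Proof.
elim: s k => [//|A s IHs] k /=; rewrite /step; congr gmean; apply/funext => t.
by rewrite gauge_shift_at IHs mul1r.
Qed.

(** By Cameron-Martin, the Gaussian of variance [x] and mean [sg * x] is the centred one weighted by
    its likelihood ratio. The sign enters that ratio only, so all gauges share one reference law. *)
Lemma step_tilt (sg x : R) A (Phi : ({set V} -> R) -> R) k :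
  sg * sg = 1 -> 0 <= x -> lip Phi ->
  step sg A x Phi k = gmean (fun t => Phi (shift_at k A (Num.sqrt x * t)) *
    expR (sg * Num.sqrt x * t - x / 2)).
Proof.
move=> sg1 x0 lP; have [L PL] := lP.
pose G t := Phi (shift_at k A (Num.sqrt x * t)).
have gG : exp_growth G.
  exact: (exp_growth_scale (Num.sqrt x) (exp_growth_lipschitz (lip_slice k A PL))).
have sqx : Num.sqrt x * Num.sqrt x = x by rewrite -expr2 sqr_sqrtr.
have GE : gmean (fun t => G (t + sg * Num.sqrt x)) =
    gmean (fun t => G t * expR (sg * Num.sqrt x * t - x / 2)).
  rewrite gmean_shift//; congr gmean; apply/funext => t.
  congr (_ * expR (_ - _ / 2)).
  by rewrite expr2 mulrACA sg1 mul1r.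
rewrite -GE /step.
have : sg ^+ 2 == 1 by rewrite expr2 sg1.
rewrite sqrf_eq1 => /orP[] /eqP ->.
  congr gmean; apply/funext => t; rewrite /G !mul1r; congr (Phi (shift_at _ _ _)).
  by rewrite mulrDr sqx.
(* For [sg = -1] the noise appears as [- Num.sqrt x * t]; reflecting [t] restores its sign and
   leaves the mean [- x]. *)
rewrite -gmean_opp; last exact: step_growth.
congr gmean; apply/funext => t; rewrite /G; congr (Phi (shift_at _ _ _)).
by transitivity (Num.sqrt x * t - Num.sqrt x * Num.sqrt x); [rewrite sqx|]; ring.
Qed.

Lemma gmean_sum (J : Type) (r : seq J) (F : J -> R -> R) :
  (forall j, exp_growth (F j)) ->
  exp_growth (fun t => \sum_(j <- r) F j t) /\
  gmean (fun t => \sum_(j <- r) F j t) = \sum_(j <- r) gmean (F j).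
Proof.
move=> gF; elim: r => [|j r [gr IHr]].
  under eq_fun do rewrite big_nil; split; first exact: exp_growth_cst.
  by rewrite big_nil gmean_cst.
under eq_fun do rewrite big_cons; split; first exact: exp_growthD.
by rewrite big_cons gmeanD// IHr.
Qed.

(* The Gibbs weights of the configurations [tau] are, up to a common factor, the
   likelihoods of [k] under the coupling laws in the gauges [tau]. *)
Lemma steps_posterior w s (Phi : {ffun V -> bool} -> ({set V} -> R) -> R) :
  (forall A, 0 <= w A) -> (forall tau, lip (Phi tau)) ->
  (forall k, \sum_tau expR (energy k tau) * Phi tau k = 0) ->
  forall k, \sum_tau expR (energy k tau) * steps (spinprod tau) w s (Phi tau) k = 0.
Proof.
move=> w0 lP P0; elim: s => [//|A s IHs] k /=.
pose F tau t := steps (spinprod tau) w s (Phi tau) (shift_at k A (Num.sqrt (w A) * t)) *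
  expR (spinprod tau A * Num.sqrt (w A) * t - w A / 2).
have gF tau : exp_growth (F tau).
  apply: exp_growthM; last exact: exp_growth_expR.
  have [L PL] := @steps_lip _ _ (spinprod tau) w s _ (lP tau).
  exact: (exp_growth_scale (Num.sqrt (w A)) (exp_growth_lipschitz (lip_slice k A PL))).
have gF' tau : exp_growth (fun t => expR (energy k tau) * F tau t).
  by apply: exp_growthM => //; exact: exp_growth_cst.
transitivity (gmean (fun t => \sum_tau expR (energy k tau) * F tau t)).
  rewrite (gmean_sum _ gF').2; apply: eq_bigr => tau _.
  rewrite gmeanZ// step_tilt//; first exact: spinprod_sqr.
  exact: steps_lip.
rewrite (_ : (fun t => _) = fun=> 0) ?gmean_cst//.
apply/funext => t; rewrite -[RHS](mulr0 (expR (- (w A / 2)))).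
rewrite -[in RHS](IHs (shift_at k A (Num.sqrt (w A) * t))) mulr_sumr.
apply: eq_bigr => tau _; rewrite /F energy_shift_at !expRD.
rewrite (_ : spinprod tau A * Num.sqrt (w A) * t = Num.sqrt (w A) * t * spinprod tau A); first by ring.
by ring.
Qed.

Definition coupling_mean w (Phi : ({set V} -> R) -> R) : R :=
  steps (fun=> 1) w (enum {set V}) Phi (fun=> 0).

(** The posterior identity is started at zero couplings, where every weight is 1: the prior on [tau]
    is uniform. The laws in the various gauges are then pulled back to the all-plus one. *)
Lemma nishimori w (Phi : {ffun V -> bool} -> ({set V} -> R) -> R) :
  (forall A, 0 <= w A) -> (forall tau, lip (Phi tau)) ->
  (forall k, \sum_tau expR (energy k tau) * Phi tau k = 0) ->
  \sum_tau coupling_mean w (fun k => Phi tau (gauge tau k)) = 0.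
Proof.
move=> w0 lP P0; rewrite -[RHS](@steps_posterior w (enum {set V}) _ w0 lP P0 (fun=> 0)).
apply: eq_bigr => tau _; rewrite /coupling_mean -steps_gauge gauge0.
rewrite (_ : energy _ _ = 0) ?expR0 ?mul1r//.
by rewrite /energy big1// => A _; rewrite mul0r.
Qed.

(** If gauging removes the dependence on [tau], all summands coincide and each must vanish. An
    identity is thus obtained from a family with zero Gibbs average over [tau] whose gauged form is
    [Psi]. *)
Lemma nishimori_cst w (Phi : {ffun V -> bool} -> ({set V} -> R) -> R)
    (Psi : ({set V} -> R) -> R) :
  (forall A, 0 <= w A) -> (forall tau, lip (Phi tau)) ->
  (forall k, \sum_tau expR (energy k tau) * Phi tau k = 0) ->
  (forall tau k, Phi tau (gauge tau k) = Psi k) -> coupling_mean w Psi = 0.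
Proof.
move=> w0 lP P0 PP; have := nishimori w0 lP P0.
rewrite (eq_bigr (fun=> coupling_mean w Psi)); last first.
  by move=> tau _; congr (coupling_mean w _); apply/funext => k; exact: PP.
rewrite sumr_const -mulr_natl => /eqP; rewrite mulf_eq0 => /orP[|/eqP//].
by rewrite pnatr_eq0 => /eqP /card0_eq /(_ [ffun=> true]); rewrite !inE.
Qed.

Lemma coupling_meanB w Psi Phi : lip Psi -> lip Phi ->
  coupling_mean w (fun k => Psi k - Phi k) = coupling_mean w Psi - coupling_mean w Phi.
Proof. by move=> lP lF; rewrite /coupling_mean stepsB. Qed.

Lemma coupling_meanD w Psi Phi : lip Psi -> lip Phi ->
  coupling_mean w (fun k => Psi k + Phi k) = coupling_mean w Psi + coupling_mean w Phi.
Proof. by move=> lP lF; rewrite /coupling_mean stepsD. Qed.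

Lemma coupling_meanZ w (a : R) Psi : lip Psi ->
  coupling_mean w (fun k => a * Psi k) = a * coupling_mean w Psi.
Proof. by move=> lP; rewrite /coupling_mean stepsZ. Qed.

Lemma coupling_mean_cst w (a : R) : coupling_mean w (fun=> a) = a.
Proof. by rewrite /coupling_mean steps_cst. Qed.

Lemma weighted_sum f k : \sum_tau expR (energy k tau) * f tau = weighted f k.
Proof. by apply: eq_bigr => tau _; rewrite mulrC. Qed.

Lemma weighted1E k : weighted (fun=> 1) k = \sum_S expR (energy k S).
Proof. by apply: eq_bigr => S _; rewrite mul1r. Qed.

Lemma weightedE f k : weighted f k = gibbs_avg f k * weighted (fun=> 1) k.
Proof. by rewrite divfK// weighted1_neq0. Qed.

Lemma coupling_mean_magnet_sqr w A : (forall A, 0 <= w A) ->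
  coupling_mean w (fun k => magnet A k ^+ 2) = coupling_mean w (magnet A).
Proof.
move=> w0; apply/esym/eqP; rewrite -subr_eq0 -coupling_meanB//; first last.
- exact: lip_magnet_sqr.
- exact: lip_magnet.
(* The Gibbs average of [tau_A] is [m_A], so this family averages to 0; gauging turns it into
   [m_A - m_A ^ 2]. *)
apply/eqP; apply: (@nishimori_cst w
  (fun tau k => spinprod tau A * magnet A k - magnet A k ^+ 2)) => //.
- move=> tau; apply: lipB; last exact: lip_magnet_sqr.
  by apply: lipZ; exact: lip_magnet.
- move=> k; rewrite weighted_sum /weighted.
  rewrite (eq_bigr (fun S => magnet A k * (spinprod S A * expR (energy k S)) -
    magnet A k ^+ 2 * (1 * expR (energy k S)))); last by move=> S _; ring.
  rewrite sumrB -!mulr_sumr mul1r -weighted1E.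
  by rewrite -/(weighted (fun S => spinprod S A) k) (weightedE (fun S => spinprod S A)) -/(magnet A k); ring.
move=> tau k; rewrite magnet_gauge mulrA spinprod_sqr mul1r.
by rewrite exprMn [_ ^+ 2](spinprod_sqr _ _) mul1r.
Qed.

Lemma coupling_mean_corr w A B : (forall A, 0 <= w A) ->
  coupling_mean w (fun k => corr A B k - magnet B k * corr A B k) =
  coupling_mean w (fun k => corr A B k ^+ 2).
Proof.
move=> w0; have lc := @lip_corr R V A B; have lm := @lip_magnet R V B.
have lmc := @lip_magnet_corr R V A B; have lcc := @lip_corr_sqr R V A B.
apply/eqP; rewrite -subr_eq0 -coupling_meanB//; last exact: lipB.
(* Averaging over [tau] gives [(<S_A S_B> - m_A m_B) c_AB - c_AB ^ 2 = 0]. The factors [tau_A tau_B]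
   and [tau_A] are those that cancel the signs produced by gauging [c_AB] and [m_B c_AB]. *)
apply/eqP; apply: (@nishimori_cst w (fun tau k =>
  spinprod tau A * spinprod tau B * corr A B k -
  spinprod tau A * (magnet B k * corr A B k) - corr A B k ^+ 2)) => //.
- by move=> tau; apply: lipB => //; apply: lipB; exact: lipZ.
- move=> k; rewrite weighted_sum /weighted.
  rewrite (eq_bigr (fun S =>
    corr A B k * (spinprod S A * spinprod S B * expR (energy k S)) -
    magnet B k * corr A B k * (spinprod S A * expR (energy k S)) -
    corr A B k ^+ 2 * (1 * expR (energy k S)))); last by move=> S _; ring.
  rewrite !sumrB -!mulr_sumr mul1r -weighted1E.
  rewrite -/(weighted (fun S => spinprod S A * spinprod S B) k).
  rewrite -/(weighted (fun S => spinprod S A) k).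
  by rewrite (weightedE (fun S => spinprod S A)) (weightedE (fun S => _ * _)) -/(magnet A k) /corr; ring.
move=> tau k; rewrite corr_gauge magnet_gauge.
have sA := spinprod_sqr (R := R) tau A; have sB := spinprod_sqr (R := R) tau B.
set a := spinprod tau A in sA *; set b := spinprod tau B in sB *.
set c := corr A B k; set m := magnet B k.
transitivity ((a * a) * (b * b) * c - (a * a) * (b * b) * (m * c) - (a * a) * (b * b) * c ^+ 2).
  by ring.
by rewrite sA sB !mul1r.
Qed.

Lemma ler_dist_coupling_mean w C Psi Phi : lip Psi -> lip Phi ->
  (forall k, `|Psi k - Phi k| <= C) -> `|coupling_mean w Psi - coupling_mean w Phi| <= C.
Proof. by move=> lP lF PF; exact: steps_dist. Qed.

Lemma coupling_mean_shift_at w A (x : R) Psi : (forall A, 0 <= w A) -> 0 <= x -> lip Psi ->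
  coupling_mean (shift_at w A x) Psi = coupling_mean w (step 1 A x Psi).
Proof.
move=> w0 x0 lP; rewrite /coupling_mean steps_shift_at//; first exact: enum_uniq.
by rewrite mem_enum.
Qed.

Lemma coupling_mean_log_partition_step A : exists C : R,
  forall w (d s : R), (forall A, 0 <= w A) -> 0 <= s <= 1 -> 0 <= d <= s ^+ 2 ->
  `|coupling_mean (shift_at w A d) log_partition - coupling_mean w log_partition
    - d * (2^-1 * (1 + coupling_mean w (magnet A)))| <= C * s ^+ 3.
Proof.
have [C C0 CT] := @log_partition_taylor R V A.
(* The [+ 1] bounds the quadratic coefficient [(1 - m_A ^ 2) / 2]. *)
exists (C * gmean (fun t : R => (`|t| + 1) ^+ 3) + 1) => w d s w0 s01 ds.
have lL := @lip_log_partition R V; have lm := @lip_magnet R V A.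
have lm2 := @lip_magnet_sqr R V A.
have d0 : 0 <= d by case/andP: ds.
rewrite coupling_mean_shift_at//.
have lS := step_lip 1 A d lL.
have lQ : lip (fun k => magnet A k + 2^-1 * (1 - magnet A k ^+ 2)).
  by apply: lipD => //; apply: lipZ; apply: lipB => //; exact: lip_cst.
have EQ : coupling_mean w (fun k => magnet A k + 2^-1 * (1 - magnet A k ^+ 2)) =
    2^-1 * (1 + coupling_mean w (magnet A)).
  rewrite coupling_meanD//; last by apply: lipZ; apply: lipB => //; exact: lip_cst.
  rewrite coupling_meanZ; last by apply: lipB => //; exact: lip_cst.
  rewrite coupling_meanB//; last exact: lip_cst.
  by rewrite coupling_mean_cst coupling_mean_magnet_sqr//; field.
rewrite -EQ -coupling_meanZ// -addrA -opprD -coupling_meanD//; last exact: lipZ.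
apply: ler_dist_coupling_mean => //; first by apply: lipD => //; exact: lipZ.
move=> k; have H := step_taylor s01 ds C0 lL (CT k).
rewrite opprD addrA [2^-1 * _]mulrC; apply: le_trans H _.
have s3 : 0 <= s ^+ 3 by rewrite exprn_ge0//; case/andP: s01.
rewrite mulrC ler_wpM2r// lerD2l.
have := magnet_le1 A k; rewrite ler_norml => /andP[m1 m2].
by rewrite ger0_norm; nra.
Qed.

Lemma coupling_mean_magnet_step A B : exists C : R,
  forall w (d s : R), (forall A, 0 <= w A) -> 0 <= s <= 1 -> 0 <= d <= s ^+ 2 ->
  `|coupling_mean (shift_at w B d) (magnet A) - coupling_mean w (magnet A)
    - d * coupling_mean w (fun k => corr A B k ^+ 2)| <= C * s ^+ 3.
Proof.
have [C C0 CT] := @magnet_taylor R V A B.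
(* The [+ 2] bounds the quadratic coefficient [- m_B c_AB], by [|m_B| <= 1] and [|c_AB| <= 2]. *)
exists (C * gmean (fun t : R => (`|t| + 1) ^+ 3) + 2) => w d s w0 s01 ds.
have lc := @lip_corr R V A B; have lm := @lip_magnet R V A.
have lmc := @lip_magnet_corr R V A B.
have d0 : 0 <= d by case/andP: ds.
rewrite coupling_mean_shift_at// -coupling_mean_corr//.
have lS := step_lip 1 B d lm.
have lQ := lipB lc lmc.
rewrite -coupling_meanZ// -addrA -opprD -coupling_meanD//; last exact: lipZ.
apply: ler_dist_coupling_mean => //; first by apply: lipD => //; exact: lipZ.
move=> k; have H := step_taylor s01 ds C0 lm (CT k).
rewrite opprD addrA; apply: le_trans H _.
have s3 : 0 <= s ^+ 3 by rewrite exprn_ge0//; case/andP: s01.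
rewrite mulrC ler_wpM2r// lerD2l normrN normrM -[leRHS]mul1r.
by rewrite ler_pM// ?magnet_le1 ?corr_le2.
Qed.

Lemma coupling_mean_step_dist (Psi : ({set V} -> R) -> R) : lip Psi ->
  exists C : R, continuous_expansion C (coupling_mean^~ Psi).
Proof.
move=> lP; have [L PL] := lP.
exists (L * gmean (fun t : R => `|t| + 1)) => w A d s w0 s01 ds.
have d0 : 0 <= d by case/andP: ds.
rewrite coupling_mean_shift_at//; apply: ler_dist_coupling_mean => //.
  exact: step_lip.
by move=> k; rewrite mulrC; exact: step_dist.
Qed.

Lemma coupling_mean_sum w (J : Type) (r : seq J) (P : pred J) (F : J -> ({set V} -> R) -> R) :
  (forall j, lip (F j)) ->
  coupling_mean w (fun k => \sum_(j <- r | P j) F j k) =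
  \sum_(j <- r | P j) coupling_mean w (F j).
Proof. by move=> lF; rewrite /coupling_mean steps_sum. Qed.

Lemma coupling_mean_corr_sqr_psd w (h : {set V} -> R) :
  0 <= \sum_A \sum_B h A * h B * coupling_mean w (fun k => corr A B k ^+ 2).
Proof.
have lP A B : lip (fun k => h A * h B * corr A B k ^+ 2).
  by apply: lipZ; exact: lip_corr_sqr.
have lS A : lip (fun k => \sum_B h A * h B * corr A B k ^+ 2).
  exact: (@lip_sum _ _ _ (index_enum _) xpredT (fun B k => h A * h B * corr A B k ^+ 2)).
rewrite (_ : \sum_A _ = coupling_mean w
    (fun k => \sum_A \sum_B h A * h B * corr A B k ^+ 2)).
  apply: steps_ge0; last exact: corr_sqr_psd.
  exact: (@lip_sum _ _ _ (index_enum _) xpredT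
    (fun A k => \sum_B h A * h B * corr A B k ^+ 2)).
rewrite coupling_mean_sum//.
apply: eq_bigr => A _; rewrite coupling_mean_sum//; apply: eq_bigr => B _.
by rewrite coupling_meanZ//; exact: lip_corr_sqr.
Qed.

End Nishimori.

(** * Tangent inequality for the free energy *)

Section Convexity.
Set Implicit Arguments.
Unset Strict Implicit.
Context {R : realType} {V : finType}.
Implicit Types (w x : {set V} -> R) (A B : {set V}).

(** The sum of the absolute values of the chosen constants dominates each of them, as [J] is
    finite. *)
Lemma uniform_constant (J : finType) (P : J -> R -> Prop) :
  (forall j a b, P j a -> a <= b -> P j b) -> (forall j, exists a, P j a) ->
  exists2 a, 0 <= a & forall j, P j a.
Proof.
move=> Pmono /choice[a Pa]; exists (\sum_j `|a j|); first exact: sumr_ge0.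
move=> j; apply: Pmono (Pa j) _; rewrite (bigD1 j)//= (le_trans (ler_norm _))// lerDl.
exact: sumr_ge0.
Qed.

Lemma continuous_expansion_le (I : finType) (G : (I -> R) -> R) a b :
  continuous_expansion a G -> a <= b -> continuous_expansion b G.
Proof.
move=> Ga ab w i d s w0 s01 ds; apply: le_trans (Ga _ _ _ _ w0 s01 ds) _.
by rewrite ler_wpM2r//; case/andP: s01.
Qed.

Lemma continuous_expansionZ (I : finType) (G : (I -> R) -> R) (a b C : R) :
  continuous_expansion C G -> continuous_expansion (`|b| * C) (fun v => b * (a + G v)).
Proof.
move=> GC w i d s w0 s01 ds; rewrite -mulrBr normrM -mulrA ler_wpM2l//.
rewrite (_ : _ - _ = G (shift_at w i d) - G w); last by ring.
exact: GC.
Qed.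

Definition free_energy w : R := coupling_mean w log_partition.
Definition slope A w : R := 2^-1 * (1 + coupling_mean w (magnet A)).
(** The summand 0 gives it the shape [b * (a + G v)] shared with [slope], to which
    [continuous_expansionZ] applies. *)
Definition curvature A B w : R := 2^-1 * (0 + coupling_mean w (fun k => corr A B k ^+ 2)).

Lemma free_energy_tangent x0 x1 : (forall A, 0 <= x0 A) -> (forall A, 0 <= x1 A) ->
  free_energy x0 + \sum_A (x1 A - x0 A) * slope A x0 <= free_energy x1.
Proof.
have half : `|2^-1 : R| = 2^-1 by rewrite ger0_norm.
have [C1 C10 HC1] : exists2 a, 0 <= a & forall A w (d s : R), nneg w -> 0 <= s <= 1 ->
    0 <= d <= s ^+ 2 -> `|free_energy (shift_at w A d) - free_energy w - d * slope A w| <= a * s ^+ 3.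
  apply: uniform_constant => [A a b Pa ab w d s w0 s01 ds|A].
    apply: le_trans (Pa _ _ _ w0 s01 ds) _.
    by rewrite ler_wpM2r// exprn_ge0//; case/andP: s01.
  exact: coupling_mean_log_partition_step.
have [C2 C20 HC2] : exists2 a, 0 <= a & forall AB : {set V} * {set V}, forall w (d s : R),
    nneg w -> 0 <= s <= 1 -> 0 <= d <= s ^+ 2 ->
    `|slope AB.1 (shift_at w AB.2 d) - slope AB.1 w - d * curvature AB.1 AB.2 w| <= a * s ^+ 3.
  apply: uniform_constant => [A a b Pa ab w d s w0 s01 ds|[A B]].
    apply: le_trans (Pa _ _ _ w0 s01 ds) _.
    by rewrite ler_wpM2r// exprn_ge0//; case/andP: s01.
  have [C HC] := @coupling_mean_magnet_step R V A B.
  exists (2^-1 * C) => w d s w0 s01 ds /=; rewrite -mulrA -half.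
  rewrite (_ : _ - _ = 2^-1 * (coupling_mean (shift_at w B d) (magnet A) -
    coupling_mean w (magnet A) - d * coupling_mean w (fun k => corr A B k ^+ 2))); last first.
    by rewrite /slope /curvature; ring.
  by rewrite normrM ler_wpM2l// HC.
have [C3 C30 HC3] : exists2 a, 0 <= a & forall A, continuous_expansion a (slope A).
  apply: uniform_constant => [A a b|A]; first exact: continuous_expansion_le.
  have [C HC] := coupling_mean_step_dist (@lip_magnet R V A).
  by exists (`|2^-1| * C); exact: continuous_expansionZ.
have [C4 C40 HC4] : exists2 a, 0 <= a & forall AB : {set V} * {set V},
    continuous_expansion a (curvature AB.1 AB.2).
  apply: uniform_constant => [A a b|[A B]]; first exact: continuous_expansion_le.
  have [C HC] := coupling_mean_step_dist (@lip_corr_sqr R V A B).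
  by exists (`|2^-1| * C); exact: continuous_expansionZ.
move=> x00 x10.
apply: (@tangent_inequality R _ (C1 + C2 + C3 + C4) _ slope curvature) => //.
- by rewrite !addr_ge0.
- move=> w A d s w0 s01 ds; apply: le_trans (HC1 _ _ _ _ w0 s01 ds) _.
  by rewrite ler_wpM2r ?exprn_ge0//; [case/andP: s01|lra].
- move=> A w B d s w0 s01 ds; apply: le_trans (HC2 (A, B) _ _ _ w0 s01 ds) _.
  by rewrite ler_wpM2r ?exprn_ge0//; [case/andP: s01|lra].
- by move=> A; apply: continuous_expansion_le (HC3 A) _; lra.
- by move=> A B; apply: continuous_expansion_le (HC4 (A, B)) _; lra.
move=> h w w0; have := coupling_mean_corr_sqr_psd w h.
rewrite -(pmulr_rge0 _ (_ : 0 < (2 : R)^-1))//.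
rewrite mulr_sumr; under eq_bigr do rewrite mulr_sumr.
move=> /le_trans; apply; rewrite le_eqVlt; apply/orP; left; apply/eqP.
apply: eq_bigr => A _; apply: eq_bigr => B _; rewrite /curvature add0r; ring.
Qed.

End Convexity.

(** * Translation of [gaussE] into averages over couplings, and the theorem *)

Section GaussExpectation.
Set Implicit Arguments.
Unset Strict Implicit.
Context {R : realType} {V : finType}.

(** [c] selects the Gaussian variable of each coupling and [c'] is its partial inverse. A coupling
    still to be drawn starts at 0, because [step] adds its full value; any other already has the
    value given by [base]. *)
Lemma gaussE_seq_steps (T : eqType) (I : finType) (c : I -> T) (c' : T -> option I)
    (w : I -> R) (Psi : (I -> R) -> R) (s : seq T) (base : T -> R) :
  pcancel c c' -> ocancel c' c -> uniq s -> lip Psi ->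
  gaussE_seq s (fun J => (Psi (fun i => Num.sqrt (w i) * J (c i) + w i))%:E) base =
  (steps (fun=> 1) w (pmap c' s) Psi
    (fun i => if c i \in s then 0 else Num.sqrt (w i) * base (c i) + w i))%:E.
Proof.
move=> cK c'K + lP; elim: s base => [//|t s IHs] base /= /andP[ts us].
under eq_integral do rewrite IHs//.
case c't: (c' t) => [i|] /=.
  have ci : c i = t by have := c'K t; rewrite c't.
  rewrite /step -EFin_gmean; last exact/step_growth/steps_lip.
  apply: eq_integral => u _; congr ((steps _ _ _ _ _)%:E); apply/funext => j.
  rewrite /shift_at in_cons -ci (inj_eq (pcan_inj cK)); have [->|ji] /= := eqVneq j i.
    by rewrite ci (negbTE ts) mulr1 mul1r add0r.
  by rewrite mulr0 addr0.
(* The variable [t] carries no coupling: the integrand is constant in it and the law has mass 1. *)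
rewrite -[RHS](congr1 EFin (gmean_cst _)) -EFin_gmean; last exact: exp_growth_cst.
apply: eq_integral => u _; congr ((steps _ _ _ _ _)%:E); apply/funext => j.
rewrite in_cons; case: eqP => [cj|]//=.
by have := cK j; rewrite cj c't.
Qed.

Lemma gaussE_steps (T I : finType) (c : I -> T) (c' : T -> option I)
    (w : I -> R) (Psi : (I -> R) -> R) :
  pcancel c c' -> ocancel c' c -> lip Psi ->
  gaussE (fun J => (Psi (fun i => Num.sqrt (w i) * J (c i) + w i))%:E) =
  (steps (fun=> 1) w (pmap c' (enum T)) Psi (fun=> 0))%:E.
Proof.
move=> cK c'K lP; rewrite /gaussE (gaussE_seq_steps _ _ cK c'K)// ?enum_uniq//.
by congr ((steps _ _ _ _ _)%:E); apply/funext => i; rewrite mem_enum.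
Qed.

Lemma pmap_enum_inl (I J : finType) :
  pmap (fun z : I + J => if z is inl i then Some i else None) (enum {: I + J}) = enum I.
Proof.
rewrite [enum {: I + J}]enumT [in LHS]unlock [enum I]enumT pmap_cat.
have -> (r : seq J) : pmap (fun z : I + J => if z is inl i then Some i else None)
    (map inr r) = [::] by elim: r.
by rewrite cats0; elim: (Finite.enum I) => //= i r ->.
Qed.

Lemma pmap_enum_inr (I J : finType) :
  pmap (fun z : I + J => if z is inr j then Some j else None) (enum {: I + J}) = enum J.
Proof.
rewrite [enum {: I + J}]enumT [in LHS]unlock [enum J]enumT pmap_cat.
have -> (r : seq I) : pmap (fun z : I + J => if z is inr j then Some j else None)
    (map inl r) = [::] by elim: r.
by elim: (Finite.enum J) => //= j r ->.
Qed.

Lemma gaussE_inl (w : {set V} -> R) (Psi : ({set V} -> R) -> R) : lip Psi ->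
  gaussE (fun J : {set V} + {set V} -> R =>
    (Psi (fun A => Num.sqrt (w A) * J (inl A) + w A))%:E) = (coupling_mean w Psi)%:E.
Proof.
move=> lP; rewrite /coupling_mean -(pmap_enum_inl {set V} {set V}).
by apply: gaussE_steps => //; case.
Qed.

Lemma gaussE_inr (w : {set V} -> R) (Psi : ({set V} -> R) -> R) : lip Psi ->
  gaussE (fun J : {set V} + {set V} -> R =>
    (Psi (fun A => Num.sqrt (w A) * J (inr A) + w A))%:E) = (coupling_mean w Psi)%:E.
Proof.
move=> lP; rewrite /coupling_mean -(pmap_enum_inr {set V} {set V}).
by apply: gaussE_steps => //; case.
Qed.

Definition restrict_to (col : {set {set V}}) (x : {set V} -> R) (A : {set V}) : R :=
  if A \in col then x A else 0.

Lemma restrict_to_ge0 (col : {set {set V}}) (x : {set V} -> R) : (forall A, A \in col -> 0 <= x A) ->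
  forall A, 0 <= restrict_to col x A.
Proof. by move=> x0 A; rewrite /restrict_to; case: ifP => // /x0. Qed.

Lemma sum_restrict_to (col : {set {set V}}) (x F : {set V} -> R) :
  \sum_(A in col) x A * F A = \sum_A restrict_to col x A * F A.
Proof.
rewrite big_mkcond; apply: eq_bigr => A _; rewrite /restrict_to.
by case: ifP => //; rewrite mul0r.
Qed.

(** A subset outside [col] gets strength 0, and then its coupling is 0 whatever the value of [J]. *)
Lemma hamilE (col : {set {set V}}) (x J : {set V} -> R) S : hamil col x J S =
  energy (fun A => Num.sqrt (restrict_to col x A) * J A + restrict_to col x A) S.
Proof.
rewrite /hamil big_mkcond; apply: eq_bigr => A _; rewrite /restrict_to.
by case: ifP => //; rewrite sqrtr0 mul0r addr0 mul0r.
Qed.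

Lemma ZpartE (col : {set {set V}}) (x J : {set V} -> R) : Zpart col x J =
  weighted (fun=> 1) (fun A => Num.sqrt (restrict_to col x A) * J A + restrict_to col x A).
Proof. by apply: eq_bigr => S _; rewrite hamilE mul1r. Qed.

Lemma gibbsE (col : {set {set V}}) (x J : {set V} -> R) f : gibbs col x J f =
  gibbs_avg f (fun A => Num.sqrt (restrict_to col x A) * J A + restrict_to col x A).
Proof. by congr (_ / _); [apply: eq_bigr => S _; rewrite hamilE|exact: ZpartE]. Qed.

End GaussExpectation.

(* The Gaussian family is J : {set V} + {set V} -> R; J (inl A) = J_A for
   A in A1, J (inr B) = J_B for B in A0 (unused coordinates are harmless). *)
Theorem theorem2 (R : realType) (V : finType) (A1 A0 : {set {set V}})
  (x1 x0 : {set V} -> R) :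
  (forall A, A \in A1 -> A != finset.set0) ->
  (forall B, B \in A0 -> B != finset.set0) ->
  (forall A, A \in A1 -> 0 <= x1 A) ->
  (forall B, B \in A0 -> 0 <= x0 B) ->
  (gaussE (fun J : {set V} + {set V} -> R =>
      (ln (Zpart A1 x1 (fun A => J (inl A))))%:E)
   >=
   gaussE (fun J : {set V} + {set V} -> R =>
      (ln (Zpart A0 x0 (fun B => J (inr B))))%:E)
   + gaussE (fun J : {set V} + {set V} -> R =>
      (2^-1 * \sum_(A in A1) x1 A *
          (1 + gibbs A0 x0 (fun B => J (inr B)) (fun S => spinprod S A))
       - 2^-1 * \sum_(B in A0) x0 B *
          (1 + gibbs A0 x0 (fun B => J (inr B)) (fun S => spinprod S B)))%:E))%E.
Proof.
move=> _ _ x1_ge0 x0_ge0.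
set w1 := restrict_to A1 x1; set w0 := restrict_to A0 x0.
have lF A : lip (fun k => (w1 A - w0 A) * (2^-1 * (1 + magnet A k))).
  by do 2 apply: lipZ; apply: lipD; [exact: lip_cst|exact: lip_magnet].
(* Once both sums are extended by 0 to all subsets, the correction is a single function of the
   couplings of [Z_0], so its expectation is a [coupling_mean] at [w0]. *)
pose G (k : {set V} -> R) := \sum_A (w1 A - w0 A) * (2^-1 * (1 + magnet A k)).
have -> : gaussE (fun J : {set V} + {set V} -> R =>
    (ln (Zpart A1 x1 (fun A => J (inl A))))%:E) = (coupling_mean w1 log_partition)%:E.
  rewrite -gaussE_inl; last exact: lip_log_partition.
  by congr gaussE; apply/funext => J; rewrite ZpartE.
have -> : gaussE (fun J : {set V} + {set V} -> R =>
    (ln (Zpart A0 x0 (fun B => J (inr B))))%:E) = (coupling_mean w0 log_partition)%:E.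
  rewrite -gaussE_inr; last exact: lip_log_partition.
  by congr gaussE; apply/funext => J; rewrite ZpartE.
rewrite [X in (_ + X)%E](_ : _ = (coupling_mean w0 G)%:E); last first.
  rewrite -gaussE_inr; last exact: (@lip_sum _ _ _ (index_enum _) xpredT
    (fun A k => (w1 A - w0 A) * (2^-1 * (1 + magnet A k)))).
  congr gaussE; apply/funext => J; congr EFin.
  rewrite !sum_restrict_to -/w1 -/w0 -mulrBr -sumrB /G mulr_sumr.
  apply: eq_bigr => A _; rewrite gibbsE -/w0 -/(magnet A _).
  by ring.
rewrite -EFinD lee_fin.
have := free_energy_tangent (restrict_to_ge0 x0_ge0) (restrict_to_ge0 x1_ge0).
rewrite -/w1 -/w0; apply: le_trans; rewrite lerD2l.
rewrite /G coupling_mean_sum//; apply: ler_sum => A _.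
rewrite coupling_meanZ; last by apply: lipZ; apply: lipD; [exact: lip_cst|exact: lip_magnet].
rewrite coupling_meanZ; last by apply: lipD; [exact: lip_cst|exact: lip_magnet].
rewrite coupling_meanD; [|exact: lip_cst|exact: lip_magnet].
by rewrite coupling_mean_cst.
Qed.
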